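(* Let $\mathcal{B}(\Omega)$ be a strong $\ell^2$-valued Bergman-type space whose constant $\kappa$ from property (A.6) satisfies $\kappa>0$. Let $F:\Omega\to\mathcal{L}(\ell^2)$ be measurable, with pointwise adjoint $F^*$, and suppose that for some $p$ with $\frac{4-\kappa}{2-\kappa}<p<\infty$ $$\sup_{i\in\mathbb{N}}\sup_{z\in\Omega}\sum_{k=1}^{\infty}\left\|\left\langle (F^*\circ\varphi_z)e_i,e_k\right\rangle_{\ell^2}\right\|_{L^p(\Omega,\mathbb{C};d\sigma)}<\infty$$ and $$\sup_{k\in\mathbb{N}}\sup_{z\in\Omega}\sum_{i=1}^{\infty}\left\|\left\langle (F\circ\varphi_z)e_k,e_i\right\rangle_{\ell^2}\right\|_{L^p(\Omega,\mathbb{C};d\sigma)}<\infty.$$ Then the Toeplitz operator $T_F$ is bounded on $\mathcal{B}(\Omega)$.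
   Context: Notation: $\{e_k\}_{k\ge1}$ is the standard orthonormal basis of $\ell^2$; a vector $e\in\ell^2$ is finite if only finitely many coordinates are nonzero. A function $f:\Omega\to\ell^2$ is measurable (analytic) if every $\langle f(\cdot),e_k\rangle_{\ell^2}$ is; $F:\Omega\to\mathcal{L}(\ell^2)$ (bounded operators on $\ell^2$) is measurable if every $\langle F(\cdot)e_k,e_i\rangle_{\ell^2}$ is. $L^2(\Omega,\ell^2;d\sigma)$ has inner product $\int_\Omega\langle f,g\rangle_{\ell^2}d\sigma$. A strong $\ell^2$-valued Bergman-type space $\mathcal{B}(\Omega)$ is given by the following data and assumptions. (A.1) $\Omega\subset\mathbb{C}^n$ is a connected open set containing $0$; for each $z\in\Omega$ there is an involution $\varphi_z\in\mathrm{Aut}(\Omega)$ (biholomorphic, $\varphi_z\circ\varphi_z=\mathrm{id}$) with $\varphi_z(0)=z$. (A.2) $\mathfrak{d}$ is a metric on $\Omega$ with $\mathfrak{d}(u,v)=\mathfrak{d}(\varphi_z(u),\varphi_z(v))$ for all $z,u,v$; $(\Omega,\mathfrak{d})$ is separable and its closed balls are compact. $D(z,r)$ is the $\mathfrak{d}$-ball of center $z$ and radius $r$. (A.3) $\sigma$ is a finite Borel measure on $\Omega$. $\mathcal{B}(\Omega)$ is the space of analytic $f:\Omega\to\ell^2$ in $L^2(\Omega,\ell^2;d\sigma)$, and $\mathcal{B}(\Omega,\mathbb{C})$ the space of scalar analytic functions in $L^2(\Omega,\mathbb{C};d\sigma)$, with the inherited norms and inner products. They are reproducing kernel Hilbert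 spaces: there are $K_z\in\mathcal{B}(\Omega,\mathbb{C})$ with $f(z)=\int_\Omega\overline{K_z(w)}f(w)\,d\sigma(w)$ for all $z\in\Omega$ and all $f$ in $\mathcal{B}(\Omega,\mathbb{C})$ or in $\mathcal{B}(\Omega)$ (coordinatewise integral). $k_z:=K_z/\|K_z\|_{\mathcal{B}(\Omega,\mathbb{C})}$, and $z\mapsto\|K_z\|_{\mathcal{B}(\Omega,\mathbb{C})}$ is continuous on $(\Omega,\mathfrak{d})$. (A.4) $d\lambda(z):=\|K_z\|^2_{\mathcal{B}(\Omega,\mathbb{C})}d\sigma(z)$ satisfies $\lambda(E)=\lambda(\varphi_z(E))$ for Borel $E$ and all $z$, and is doubling: $\lambda(D(z,2r))\le C\lambda(D(z,r))$ for all $z\in\Omega$, $r>0$, for some $C>1$. (A.5) $|\langle k_z,k_w\rangle_{\mathcal{B}(\Omega,\mathbb{C})}|= 1/\|K_{\varphi_z(w)}\|_{\mathcal{B}(\Omega,\mathbb{C})}$ for all $z,w$. (A.6) Either there is $0<\kappa<2$ such that $$\int_\Omega\frac{|\langle K_z,K_w\rangle|^{(r+s)/2}}{\|K_z\|^s\|K_w\|^r}\,d\lambda(w)\le C(r,s)<\infty\quad\text{for all }z\in\Omega$$ (norms and inner products in $\mathcal{B}(\Omega,\mathbb{C})$) for all $r>\kappa>s>0$; or this holds for all $r=s>0$, in which case one sets $\kappa=0$. (A.7) $\|K_z\|_{\mathcal{B}(\Omega,\mathbb{C})}\to\infty$ as $\mathfrak{d}(z,0)\to\infty$. Toeplitz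 operator: $T_F=PM_F$, where $(M_Ff)(z)=F(z)f(z)$ and $P$ is the orthogonal projection of $L^2(\Omega,\ell^2;d\sigma)$ onto $\mathcal{B}(\Omega)$, given by $Pf(z)=\int_\Omega\langle K_w,K_z\rangle_{\mathcal{B}(\Omega,\mathbb{C})}f(w)\,d\sigma(w)$. $T_F$ is a priori considered on finite sums of functions $w\mapsto k_z(w)h$ with $z\in\Omega$ and $h\in\ell^2$ finite (a dense subspace of $\mathcal{B}(\Omega)$); boundedness means that it extends to a bounded operator on $\mathcal{B}(\Omega)$. *)

(* Defs.v *)
From HB Require Import structures.
From mathcomp Require Import all_boot all_order all_algebra.
From mathcomp Require Import all_classical all_reals all_analysis.
From mathcomp Require Import complex ring lra.

Set Implicit Arguments.
Unset Strict Implicit.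
Unset Printing Implicit Defensive.

Import Order.TTheory GRing.Theory Num.Theory.
Import numFieldNormedType.Exports.

Local Open Scope classical_set_scope.
Local Open Scope ring_scope.

(* The usual topology of the complex numbers, as a normed space over itself;
   it makes ['rV[R[i]]_n] a complex normed space, and [differentiable] between
   such spaces is complex differentiability. *)
HB.instance Definition _ (R : realType) := NormedModule.copy R[i] (R[i])^o.

(* The real-valued modulus; [`|x|] itself is an element of [R[i]]. *)
Notation normc := Normc.normc.

Section ell2.
Variable R : realType.
Local Notation C := R[i].

Definition square_summable (x : nat -> C) : Prop :=
  (\sum_(0 <= k <oo) (normc (x k) ^+ 2)%:E < +oo)%E.

Definition square_summable_pred : {pred nat -> C} :=
  fun x => `[< square_summable x >].

Lemma normc_ge0 (x : C) : 0 <= normc x.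
Proof. by case: x => a b; rewrite sqrtr_ge0. Qed.

Lemma sqr_normcD_le (x y : C) :
  normc (x + y) ^+ 2 <= 2 * normc x ^+ 2 + 2 * normc y ^+ 2.
Proof.
have /le_trans -> // : normc (x + y) ^+ 2 <= (normc x + normc y) ^+ 2.
  by rewrite ler_sqr ?nnegrE ?addr_ge0 ?normc_ge0// le_normcD.
rewrite -subr_ge0 (_ : _ - _ = (normc x - normc y) ^+ 2) ?sqr_ge0//.
by ring.
Qed.

Lemma square_summable_submod : GRing.submod_closed square_summable_pred.
Proof.
split=> [|a x y].
  apply/asboolP; rewrite /square_summable eseries0// => k _ _.
  by rewrite Normc.normc0 expr0n.
move=> /asboolP xs /asboolP ys; apply/asboolP; rewrite /square_summable.
have nn (c : R) (z : nat -> C) k : 0 <= c ->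
    (0 <= (c * normc (z k) ^+ 2)%:E)%E.
  by move=> c0; rewrite lee_fin mulr_ge0// sqr_ge0.
apply: (@le_lt_trans _ _ (\sum_(0 <= k <oo)
    ((2 * normc a ^+ 2)%:E * (normc (x k) ^+ 2)%:E
     + 2%:E * (normc (y k) ^+ 2)%:E))%E).
  apply: lee_nneseries => k _; first by rewrite lee_fin sqr_ge0.
  rewrite -!EFinM -EFinD lee_fin (le_trans (sqr_normcD_le _ _))//=.
  by rewrite Normc.normcM exprMn mulrA.
rewrite nneseriesD; last 2 first.
- by move=> k _ _; rewrite -EFinM nn// mulr_ge0// sqr_ge0.
- by move=> k _ _; rewrite -EFinM nn.
rewrite !nneseriesZl; last 2 first.
- by move=> k _; rewrite lee_fin sqr_ge0.
- by move=> k _; rewrite lee_fin sqr_ge0.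
have fin (z : nat -> C) : square_summable z ->
    (\sum_(0 <= k <oo) (normc (z k) ^+ 2)%:E)%E \is a fin_num.
  move=> zs; rewrite ge0_fin_numE//.
  by apply: nneseries_ge0 => k _ _; rewrite lee_fin sqr_ge0.
by rewrite lte_add_pinfty// ltey_eq fin_numM// ?fin.
Qed.

HB.instance Definition _ :=
  GRing.isSubmodClosed.Build C (nat -> C) square_summable_pred
    square_summable_submod.

Record ell2 := Ell2 {
  ell2_val :> nat -> C ;
  ell2_valP : ell2_val \in square_summable_pred }.

HB.instance Definition _ := [isSub for ell2_val].
HB.instance Definition _ := [Choice of ell2 by <:].
HB.instance Definition _ := [SubChoice_isSubLmodule of ell2 by <:].

(* Linear in the first argument. *)
Definition ip (x y : ell2) : C := limn (series (fun k => x k * (y k)^*)).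

Definition ell2_norm (x : ell2) : R :=
  Num.sqrt (fine (\sum_(0 <= k <oo) (normc (x k) ^+ 2)%:E)%E).

Lemma finite_square_summable (x : nat -> C) (N : nat) :
  (forall k, (N <= k)%N -> x k = 0) -> x \in square_summable_pred.
Proof.
move=> x0; apply/asboolP; rewrite /square_summable.
rewrite (@nneseries_split _ _ 0%N N); last by move=> k _; rewrite lee_fin sqr_ge0.
rewrite eseries0 ?adde0 ?sumEFin ?ltry// => k Nk _.
by rewrite x0// Normc.normc0 expr0n.
Qed.

Lemma delta_square_summable (k : nat) :
  (fun i => (i == k)%:R : C) \in square_summable_pred.
Proof.
apply: (@finite_square_summable _ k.+1) => i ki.
by rewrite gtn_eqF.
Qed.

(* The standard orthonormal basis, indexed from 0. *)
Definition std_basis (k : nat) : ell2 := Ell2 (delta_square_summable k).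

Definition finite_vector (x : ell2) : Prop :=
  exists N : nat, forall k, (N <= k)%N -> ip x (std_basis k) = 0.

Record bounded_operator := BoundedOperator {
  bop_fun :> {linear ell2 -> ell2} ;
  bop_bounded : exists M : R, forall x, ell2_norm (bop_fun x) <= M * ell2_norm x }.

Definition is_adjoint (S T : bounded_operator) : Prop :=
  forall x y : ell2, ip (S x) y = ip x (T y).

End ell2.

Section metric.
Variables (R : realType) (T : choiceType) (A : set T).

Record metric_on := MetricOn {
  dist :> T -> T -> R ;
  distxx : forall x, A x -> dist x x = 0 ;
  dist_eq0 : forall x y, A x -> A y -> dist x y = 0 -> x = y ;
  dist_sym : forall x y, A x -> A y -> dist x y = dist y x ;
  dist_triangle : forall y x z, A x -> A y -> A z ->
    dist x z <= dist x y + dist y z }.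

(* The metric space (A, d): the topology on this copy of A is that of d, and
   not the one A may inherit from T. *)
Definition metric_space (d : metric_on) : Type := set_type A.

Variable d : metric_on.

HB.instance Definition _ := Choice.on (metric_space d).

Let inA (x : metric_space d) : A (set_val x) := set_mem (valP x).
Let dA (x y : metric_space d) : R := d (set_val x) (set_val y).

Let dAxx x : dA x x = 0. Proof. exact: distxx. Qed.
Let dA_eq0 x y : dA x y = 0 -> x = y.
Proof. by move=> h; apply: val_inj; apply: (dist_eq0 _ _ h). Qed.
Let dA_sym x y : dA x y = dA y x. Proof. exact: dist_sym. Qed.
Let dA_triangle y x z : dA x z <= dA x y + dA y z.
Proof. exact: dist_triangle. Qed.

HB.instance Definition _ :=
  isMetric.Build R (metric_space d) dAxx dA_eq0 dA_sym dA_triangle.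

Definition dball (z : T) (r : R) : set T := [set w | A w /\ d z w < r].

End metric.

Definition complete_subspace (R : realType) (V : zmodType) (B : set V)
    (nrm : V -> \bar R) : Prop :=
  forall u : nat -> V, (forall i, B (u i)) ->
    (forall eps : R, 0 < eps -> exists N : nat, forall i j,
       (N <= i)%N -> (N <= j)%N -> (nrm (u i - u j)%R < eps%:E)%E) ->
    exists2 f, B f & forall eps : R, 0 < eps -> exists N : nat, forall i,
       (N <= i)%N -> (nrm (u i - f)%R < eps%:E)%E.

Definition borelC (R : realType) (n : nat) :=
  g_sigma_algebraType (@open 'rV[R[i]]_n).

(* Functions on Omega are represented by functions on the whole of C^n whose
   values outside Omega are never used, and Borel measures on the open set
   Omega by Borel measures on C^n of which only the restriction to Omega is
   used. *)
Section function_spaces.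
Variables (R : realType) (n : nat).
Local Notation C := R[i].
Local Notation Cn := 'rV[C]_n.
Variables (Omega : set Cn) (sigma : {measure set (borelC R n) -> \bar R}).

Definition analytic (f : Cn -> C) : Prop :=
  forall z, Omega z -> differentiable f z.

Definition measurable_cfun (f : Cn -> C) : Prop :=
  measurable_fun (Omega : set (borelC R n)) (fun z => complex.Re (f z)) /\
  measurable_fun (Omega : set (borelC R n)) (fun z => complex.Im (f z)).

Definition integralC (f : Cn -> C) : C :=
  Complex (\int[sigma]_(w in Omega) complex.Re (f w))
          (\int[sigma]_(w in Omega) complex.Im (f w)).

Definition Lp_norm (p : R) (f : Cn -> C) : \bar R :=
  ('N[sigma]_(p%:E)[((fun z => (normc (f z))%:E) \_ Omega)])%E.

Definition L2 : set (Cn -> C) :=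
  [set f | measurable_cfun f /\ (Lp_norm 2 f < +oo)%E].

Definition bergmanC : set (Cn -> C) := [set f | analytic f /\ L2 f].

Definition normB (f : Cn -> C) : R := fine (Lp_norm 2 f).

Definition ipB (f g : Cn -> C) : C := integralC (fun w => f w * (g w)^*).

Definition analytic_l2 (f : Cn -> ell2 R) : Prop :=
  forall k, analytic (fun z => ip (f z) (std_basis R k)).

Definition measurable_l2 (f : Cn -> ell2 R) : Prop :=
  forall k, measurable_cfun (fun z => ip (f z) (std_basis R k)).

Definition measurable_op (F : Cn -> bounded_operator R) : Prop :=
  forall k i, measurable_cfun (fun z => ip (F z (std_basis R k)) (std_basis R i)).

Definition L2_norm_l2 (f : Cn -> ell2 R) : \bar R :=
  ('N[sigma]_(2%:E)[((fun z => (ell2_norm (f z))%:E) \_ Omega)])%E.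

Definition L2_l2 : set (Cn -> ell2 R) :=
  [set f | measurable_l2 f /\ (L2_norm_l2 f < +oo)%E].

Definition bergman_l2 : set (Cn -> ell2 R) :=
  [set f | analytic_l2 f /\ L2_l2 f].

Definition normB_l2 (f : Cn -> ell2 R) : R := fine (L2_norm_l2 f).

Definition ip_l2 (f g : Cn -> ell2 R) : C := integralC (fun w => ip (f w) (g w)).

Section kernel.
Variable K : Cn -> Cn -> C.

Definition reproducing : Prop :=
  [/\ forall z, Omega z -> bergmanC (K z),
      forall f z, bergmanC f -> Omega z ->
        f z = integralC (fun w => (K z w)^* * f w)
    & forall f z k, bergman_l2 f -> Omega z ->
        ip (f z) (std_basis R k) = integralC (fun w => (K z w)^* * ip (f w) (std_basis R k))].

Definition normalized_kernel (z w : Cn) : C := (real_complex R (normB (K z)))^-1 * K z w.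

(* lambda has density ||K_z||^2 with respect to sigma. *)
Definition integral_lambda (g : Cn -> \bar R) : \bar R :=
  (\int[sigma]_(w in Omega) (g w * (normB (K w) ^+ 2)%:E))%E.

Definition lambda (E : set Cn) : \bar R :=
  (\int[sigma]_(w in (E : set (borelC R n))) (normB (K w) ^+ 2)%:E)%E.

Definition rudin_forelli (r s : R) : Prop :=
  exists M : R, forall z, Omega z ->
    (integral_lambda (fun w =>
       (normc (ipB (K z) (K w)) `^ ((r + s) / 2) /
        (normB (K z) `^ s * normB (K w) `^ r))%:E) <= M%:E)%E.

End kernel.
End function_spaces.

Record bergman_type_space (R : realType) (n : nat) := BergmanTypeSpace {
  Omega : set 'rV[R[i]]_n ;
  phi : 'rV[R[i]]_n -> 'rV[R[i]]_n -> 'rV[R[i]]_n ;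
  bdist : metric_on R Omega ;
  sigma : {finite_measure set (borelC R n) -> \bar R} ;
  K : 'rV[R[i]]_n -> 'rV[R[i]]_n -> R[i] ;
  kappa : R ;

  Omega_open : open Omega ;
  Omega_connected : connected Omega ;
  Omega0 : Omega 0 ;

  (* phi_z is its own inverse, so that it is biholomorphic. *)
  phi_Omega : forall z u, Omega z -> Omega u -> Omega (phi z u) ;
  phi_holomorphic : forall z u, Omega z -> Omega u -> differentiable (phi z) u ;
  phi_involution : forall z u, Omega z -> Omega u -> phi z (phi z u) = u ;
  phi0 : forall z, Omega z -> phi z 0 = z ;

  bdist_invariant : forall z u v, Omega z -> Omega u -> Omega v ->
    bdist u v = bdist (phi z u) (phi z v) ;
  bdist_separable : exists A : set (metric_space bdist), countable A /\ dense A ;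
  bdist_proper : forall (x : metric_space bdist) (r : R),
    compact [set y : metric_space bdist | mdist x y <= r] ;

  bergmanC_complete : complete_subspace (bergmanC Omega sigma) (Lp_norm Omega sigma 2) ;
  bergman_l2_complete :
    complete_subspace (bergman_l2 Omega sigma) (L2_norm_l2 Omega sigma) ;
  K_reproducing : reproducing Omega sigma K ;
  K_norm_continuous :
    continuous (fun z : metric_space bdist => normB Omega sigma (K (set_val z))) ;

  lambda_invariant : forall z (E : set 'rV[R[i]]_n), Omega z -> E `<=` Omega ->
    measurable (E : set (borelC R n)) ->
    lambda Omega sigma K E = lambda Omega sigma K (phi z @` E) ;
  lambda_doubling : exists2 M : R, 1 < M & forall z r, Omega z -> 0 < r ->
    (lambda Omega sigma K (dball bdist z (2 * r))
       <= M%:E * lambda Omega sigma K (dball bdist z r))%E ;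

  K_phi : forall z w, Omega z -> Omega w ->
    normc (ipB Omega sigma (normalized_kernel Omega sigma K z)
                           (normalized_kernel Omega sigma K w))
    = (normB Omega sigma (K (phi z w)))^-1 ;

  kappa_rudin_forelli :
    (0 < kappa < 2 /\ forall r s, kappa < r -> 0 < s -> s < kappa ->
        rudin_forelli Omega sigma K r s) \/
    (kappa = 0 /\ forall r, 0 < r -> rudin_forelli Omega sigma K r r) ;

  K_norm_infty : forall M : R, exists r : R, forall z, Omega z ->
    r < bdist z 0 -> M < normB Omega sigma (K z) }.

Section toeplitz.
Variables (R : realType) (n : nat) (B : bergman_type_space R n).
Local Notation C := R[i].
Local Notation Cn := 'rV[C]_n.
Local Notation Omega := (Omega B).
Local Notation sigma := (sigma B).
Local Notation K := (K B).

Definition bergman : set (Cn -> ell2 R) := bergman_l2 Omega sigma.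

(* [g] is the image of [f] under the orthogonal projection of L^2 onto the
   Bergman space, whose coordinates are given by the integral formula. *)
Definition is_bergman_projection (f g : Cn -> ell2 R) : Prop :=
  [/\ bergman g,
      forall h, bergman h -> ip_l2 Omega sigma (f - g) h = 0
    & forall z k, Omega z -> ip (g z) (std_basis R k) =
        integralC Omega sigma
          (fun w => ipB Omega sigma (K w) (K z) * ip (f w) (std_basis R k))].

Definition mult_op (F : Cn -> bounded_operator R) (f : Cn -> ell2 R) :
  Cn -> ell2 R := fun z => F z (f z).

Definition kernel_span : set (Cn -> ell2 R) :=
  [set f | exists (m : nat) (z : 'I_m -> Cn) (h : 'I_m -> ell2 R),
     (forall j, Omega (z j) /\ finite_vector (h j)) /\
     f = fun w => \sum_(j < m) normalized_kernel Omega sigma K (z j) w *: h j].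

(* [bergman] is a set of functions on C^n that matter only on [Omega], so
   linearity is an equality on [Omega]. *)
Definition bounded_on_bergman (T : (Cn -> ell2 R) -> (Cn -> ell2 R)) : Prop :=
  [/\ forall f, bergman f -> bergman (T f),
      forall (a : C) f g z, bergman f -> bergman g -> Omega z ->
        T (a *: f + g) z = a *: T f z + T g z
    & exists M : R, forall f, bergman f ->
        normB_l2 Omega sigma (T f) <= M * normB_l2 Omega sigma f].

Definition toeplitz_bounded (F : Cn -> bounded_operator R) : Prop :=
  exists2 T : (Cn -> ell2 R) -> (Cn -> ell2 R), bounded_on_bergman T &
    forall f, kernel_span f ->
      L2_l2 Omega sigma (mult_op F f) /\ is_bergman_projection (mult_op F f) (T f).

End toeplitz.

(* Main.v *)
Require Import Defs.
From HB Require Import structures.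
From mathcomp Require Import all_boot all_order all_algebra.
From mathcomp Require Import all_classical all_reals all_analysis.
From mathcomp Require Import measurable_realfun.
From mathcomp Require Import complex ring lra.
Set Implicit Arguments.
Unset Strict Implicit.
Unset Printing Implicit Defensive.
Import Order.TTheory GRing.Theory Num.Theory.
Import numFieldNormedType.Exports.
Local Open Scope classical_set_scope.
Local Open Scope ring_scope.

(** Write [N z] for the norm of [K_z] and [kk z w = |K_z(w)| = |<K_z, K_w>|].

    The Toeplitz operator is bounded as soon as its sesquilinear form
    [<F f, h>] is defined and bounded on the whole Bergman space, since the
    Riesz representation theorem then provides [T f] for every [f], and testing
    against [K_z e_k] identifies [T f] with the projection of [F f].
    Expanding in coordinates and using [2 |a b| <= |a|^2 + |b|^2], the form is
    dominated by the sums over [i] and [k] of the integrals of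
    [|F_ik| |f_k|^2] and of [|F_ik| |h_i|^2].  Everything thus reduces to a
    scalar Carleson embedding ([carleson_embedding]): if the [L^p] norms of the
    functions [G_i o phi_w] have a sum bounded uniformly in [w], then the sum of
    the integrals of [|G_i| |f|^2] is at most a multiple of the square of the
    norm of [f], for every scalar [f] in the Bergman space.  It is applied to
    each column and each row of [F].

    The embedding is a Schur test with weight [N ^ alpha].  Cauchy-Schwarz in the
    reproducing formula bounds [|f u|^2] by [N u ^ alpha] times the integral of
    [kk u w |f w|^2 N w ^ (- alpha)] ([bergman_sqr_bound]).  After exchanging the
    integrals it remains to bound the integral of [|G u| kk w u N u ^ alpha] in
    [u] by a multiple of [N w ^ alpha] ([weighted_kernel_bound]).
    The substitution [u = phi_w x], under which [kk] and [N] transform by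
    [kk z w * N (phi_z w) = N z * N w] ([kernel_phi]), factors [N w ^ alpha] out
    and leaves [|G o phi_w|] against the weight
    [kk w x ^ (1 - alpha) N x ^ alpha], whose [L^q] norm, with [q] conjugate to
    [p], is bounded uniformly in [w] by a Rudin-Forelli estimate
    ([rudin_forelli_bounded]).  An exponent [alpha] that suits both steps exists
    because [p > (4 - kappa) / (2 - kappa)] ([schur_exponent]).

    All exchanges of integrals concern nonnegative functions, so the analytic
    content besides these estimates is the measurability of [N], which is lower
    semicontinuous as a supremum of continuous functions, and of [kk] in both
    variables jointly, which follows from its separate continuity. *)

(** * Complex numbers *)

Section complex_numbers.
Variable R : realType.
Local Notation C := R[i].
Implicit Types x y : C.

Lemma conjE x : x^* = conjc x. Proof. by []. Qed.

Lemma complexReD x y : complex.Re (x + y) = complex.Re x + complex.Re y.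
Proof. by case: x y => ? ? [? ?]. Qed.
Lemma complexImD x y : complex.Im (x + y) = complex.Im x + complex.Im y.
Proof. by case: x y => ? ? [? ?]. Qed.
Lemma complexReM x y : complex.Re (x * y) =
  complex.Re x * complex.Re y - complex.Im x * complex.Im y.
Proof. by case: x y => ? ? [? ?]. Qed.
Lemma complexImM x y : complex.Im (x * y) =
  complex.Re x * complex.Im y + complex.Im x * complex.Re y.
Proof. by case: x y => ? ? [? ?] /=. Qed.
Lemma complexReJ x : complex.Re x^* = complex.Re x.
Proof. by case: x. Qed.
Lemma complexImJ x : complex.Im x^* = - complex.Im x.
Proof. by case: x. Qed.
Lemma complex_ext x y :
  complex.Re x = complex.Re y -> complex.Im x = complex.Im y -> x = y.
Proof. by case: x y => ? ? [? ?] /= -> ->. Qed.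

Lemma sqr_normc x : normc x ^+ 2 = complex.Re x ^+ 2 + complex.Im x ^+ 2.
Proof.
by case: x => a b; rewrite /normc/= sqr_sqrtr ?addr_ge0 ?sqr_ge0.
Qed.

Lemma normr_normcE x : `|x| = (normc x)%:C%C.
Proof. by rewrite normc_def; case: x => a b. Qed.

Lemma normr_Re_le x : `|complex.Re x| <= normc x.
Proof.
rewrite -ler_sqr ?nnegrE ?normc_ge0// sqr_normc -normrX ger0_norm ?sqr_ge0//.
by rewrite lerDl sqr_ge0.
Qed.

Lemma normr_Im_le x : `|complex.Im x| <= normc x.
Proof.
rewrite -ler_sqr ?nnegrE ?normc_ge0// sqr_normc -normrX ger0_norm ?sqr_ge0//.
by rewrite lerDr sqr_ge0.
Qed.

Lemma normc_le_ReIm x : normc x <= `|complex.Re x| + `|complex.Im x|.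
Proof.
rewrite -ler_sqr ?nnegrE ?normc_ge0 ?addr_ge0// sqr_normc sqrrD !real_normK ?num_real//.
by rewrite addrAC lerDl mulrn_wge0// mulr_ge0.
Qed.

Lemma normc_conj x : normc x^* = normc x.
Proof. by case: x => a b; rewrite /= sqrrN. Qed.

(** Positive elements of [R[i]] are real, which turns the complex radii of the
    topology of [R[i]] into real ones. *)
Lemma ltc_real (a : R) (e : C) : 0 < e -> (a%:C%C < e) = (a < complex.Re e).
Proof.
by case: e => er ei; rewrite !ltcE /= => /andP[/eqP-> _]; rewrite eqxx.
Qed.

Lemma cvg_complex (u : nat -> C) x :
  (fun n => complex.Re (u n)) @ \oo --> complex.Re x ->
  (fun n => complex.Im (u n)) @ \oo --> complex.Im x -> u @ \oo --> x.
Proof.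
move=> /cvgrPdist_lt ur /cvgrPdist_lt ui; apply/cvgrPdist_lt => e e0.
have er0 : 0 < complex.Re e / 2.
  by rewrite divr_gt0// -ltc_real.
near=> n; rewrite normr_normcE ltc_real// (le_lt_trans (normc_le_ReIm _))//.
rewrite [ltRHS]splitr ltrD//.
  rewrite (_ : complex.Re _ = complex.Re x - complex.Re (u n)); last first.
    by case: (x) (u n) => ? ? [].
  by near: n; exact: ur.
rewrite (_ : complex.Im _ = complex.Im x - complex.Im (u n)); last first.
  by case: (x) (u n) => ? ? [].
by near: n; exact: ui.
Unshelve. all: by end_near. Qed.

Lemma cvg_Re (u : nat -> C) x : u @ \oo --> x ->
  (fun n => complex.Re (u n)) @ \oo --> complex.Re x.
Proof.
move=> /cvgrPdist_lt h; apply/cvgrPdist_lt => e e0.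
have e0' : 0 < e%:C%C by rewrite ltcR.
near=> n; have : `|x - u n| < e%:C%C by near: n; exact: h.
rewrite normr_normcE ltc_real//=; apply: le_lt_trans.
by apply: le_trans (normr_Re_le _); case: (x) (u n) => ? ? [].
Unshelve. all: by end_near. Qed.

Lemma cvg_Im (u : nat -> C) x : u @ \oo --> x ->
  (fun n => complex.Im (u n)) @ \oo --> complex.Im x.
Proof.
move=> /cvgrPdist_lt h; apply/cvgrPdist_lt => e e0.
have e0' : 0 < e%:C%C by rewrite ltcR.
near=> n; have : `|x - u n| < e%:C%C by near: n; exact: h.
rewrite normr_normcE ltc_real//=; apply: le_lt_trans.
by apply: le_trans (normr_Im_le _); case: (x) (u n) => ? ? [].
Unshelve. all: by end_near. Qed.

Lemma complexRe_sum (u : nat -> C) n :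
  complex.Re (\sum_(0 <= k < n) u k) = \sum_(0 <= k < n) complex.Re (u k).
Proof. by apply: (big_morph _ complexReD). Qed.
Lemma complexIm_sum (u : nat -> C) n :
  complex.Im (\sum_(0 <= k < n) u k) = \sum_(0 <= k < n) complex.Im (u k).
Proof. by apply: (big_morph _ complexImD). Qed.

Lemma nneseries_bounded_cvg (v : nat -> R) :
  (\sum_(0 <= k <oo) `|v k|%:E < +oo)%E -> cvgn (series v).
Proof.
move=> h; apply: normed_cvg; apply: nondecreasing_is_cvgn.
  by apply: nondecreasing_series => k _ _ /=; exact: normr_ge0.
exists (fine (\sum_(0 <= k <oo) `|v k|%:E)%E) => _ [n _ <-].
rewrite -lee_fin fineK; last first.
  by rewrite ge0_fin_numE// nneseries_ge0// => k _ _; rewrite lee_fin.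
by rewrite /series/= -sumEFin; apply: nneseries_lim_ge => k _ _; rewrite lee_fin.
Qed.

(** The real and imaginary parts are absolutely summable, hence converge. *)
Lemma abs_cvg_complex (u : nat -> C) :
  (\sum_(0 <= k <oo) (normc (u k))%:E < +oo)%E ->
  series u @ \oo --> limn (series u).
Proof.
move=> h.
have cr : cvgn (series (fun k => complex.Re (u k))).
  apply: nneseries_bounded_cvg; apply: le_lt_trans h.
  by apply: lee_nneseries => k *; rewrite lee_fin ?normr_Re_le.
have ci : cvgn (series (fun k => complex.Im (u k))).
  apply: nneseries_bounded_cvg; apply: le_lt_trans h.
  by apply: lee_nneseries => k *; rewrite lee_fin ?normr_Im_le.
apply: (@cvgP _ _ (Complex (limn (series (fun k => complex.Re (u k))))
   (limn (series (fun k => complex.Im (u k)))))).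
apply: cvg_complex => /=.
  by rewrite (_ : (fun n => _) = series (fun k => complex.Re (u k)))//;
     apply/funext => n; rewrite /series/= complexRe_sum.
by rewrite (_ : (fun n => _) = series (fun k => complex.Im (u k)))//;
   apply/funext => n; rewrite /series/= complexIm_sum.
Qed.

Lemma normc_sum_le (u : nat -> C) n :
  normc (\sum_(0 <= k < n) u k) <= \sum_(0 <= k < n) normc (u k).
Proof.
elim: n => [|n ih]; first by rewrite !big_geq// Normc.normc0.
by rewrite !big_nat_recr//= (le_trans (le_normcD _ _))// lerD2r.
Qed.

Lemma normc_lim_series_le (u : nat -> C) :
  ((normc (limn (series u)))%:E <= \sum_(0 <= k <oo) (normc (u k))%:E)%E.
Proof.
have s0 : (0 <= \sum_(0 <= k <oo) (normc (u k))%:E)%E.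
  by apply: nneseries_ge0 => k _ _; rewrite lee_fin normc_ge0.
have [h|] := ltP (\sum_(0 <= k <oo) (normc (u k))%:E)%E +oo%E; last first.
  by rewrite leye_eq => /eqP ->; rewrite leey.
have c := abs_cvg_complex h.
rewrite -(@fineK _ (\sum_(0 <= k <oo) _)%E) ?ge0_fin_numE// lee_fin.
apply/ler_addgt0Pr => e e0; rewrite addrC.
move/cvgrPdist_lt : c => /(_ e%:C%C); rewrite ltcR => /(_ e0)[N _ /(_ N (leqnn _))].
rewrite normr_normcE /= ltcR => /ltW lN.
rewrite -[limn _](@subrK _ (series u N)) (le_trans (le_normcD _ _))// lerD//.
rewrite (le_trans (normc_sum_le _ _))// -lee_fin fineK ?ge0_fin_numE//.
rewrite -sumEFin; apply: nneseries_lim_ge => k _ _; rewrite lee_fin normc_ge0//.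
Qed.

End complex_numbers.

(** * The inner product of the sequence space *)

Section ell2_theory.
Variable R : realType.
Local Notation C := R[i].
Implicit Types x y z : ell2 R.

Lemma ip_basis x k : ip x (std_basis R k) = x k.
Proof.
rewrite /ip; apply: cvg_lim => //; apply/cvgrPdist_lt => e e0.
near=> n; rewrite (_ : series _ n = x k) ?subrr ?normr0//.
have kn : (k < n)%N by near: n; exact: nbhs_infty_gt.
rewrite /series/= big_mkord (bigD1 (Ordinal kn))//= eqxx conjE conjc1 mulr1.
rewrite big1 ?addr0// => i /eqP ik; rewrite (_ : _ == _ = false) ?conjE ?conjc0 ?mulr0//.
by apply/negbTE/eqP => ?; apply: ik; exact: val_inj.
Unshelve. all: by end_near. Qed.

Lemma ell2_ext x y : (forall k, x k = y k) -> x = y.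
Proof. by move=> h; apply: val_inj; apply/funext. Qed.

Definition sqsum x : \bar R := (\sum_(0 <= k <oo) (normc (x k) ^+ 2)%:E)%E.

Lemma sqsum_ge0 x : (0 <= sqsum x)%E.
Proof. by apply: nneseries_ge0 => k _ _; rewrite lee_fin sqr_ge0. Qed.

Lemma sqsum_fin x : sqsum x \is a fin_num.
Proof.
rewrite ge0_fin_numE ?sqsum_ge0//.
by have /asboolP := ell2_valP x.
Qed.

Lemma ell2_norm_sqr x : (ell2_norm x ^+ 2)%:E = sqsum x.
Proof. by rewrite sqr_sqrtr ?fineK ?sqsum_fin// fine_ge0 ?sqsum_ge0. Qed.

Lemma ell2_norm_ge0 x : 0 <= ell2_norm x.
Proof. exact: sqrtr_ge0. Qed.

Lemma ip_term_le (a b : C) :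
  normc (a * b^*) <= (normc a ^+ 2 + normc b ^+ 2) / 2.
Proof.
rewrite Normc.normcM normc_conj.
have := sqr_ge0 (normc a - normc b); lra.
Qed.

Lemma ip_abs_le x y :
  (\sum_(0 <= k <oo) (normc (x k * (y k)^* ))%:E <=
   ((ell2_norm x ^+ 2 + ell2_norm y ^+ 2) / 2)%:E)%E.
Proof.
rewrite mulrC EFinM EFinD !ell2_norm_sqr /sqsum.
rewrite -nneseriesD; last 2 first.
- by move=> k *; rewrite lee_fin sqr_ge0.
- by move=> k *; rewrite lee_fin sqr_ge0.
rewrite -nneseriesZl; last first.
  by move=> k _; rewrite -EFinD lee_fin addr_ge0 ?sqr_ge0.
apply: lee_nneseries => k *; first by rewrite lee_fin normc_ge0.
by rewrite -EFinD -EFinM lee_fin [leRHS]mulrC; exact: ip_term_le.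
Qed.

Lemma ip_abs_fin x y : (\sum_(0 <= k <oo) (normc (x k * (y k)^* ))%:E < +oo)%E.
Proof. by rewrite (le_lt_trans (ip_abs_le _ _))// ltry. Qed.

Lemma ip_cvg x y : series (fun k => x k * (y k)^* ) @ \oo --> ip x y.
Proof. by apply: abs_cvg_complex; exact: ip_abs_fin. Qed.

Lemma ip_series_le x y :
  ((normc (ip x y))%:E <= \sum_(0 <= k <oo) (normc (x k) * normc (y k))%:E)%E.
Proof.
rewrite (le_trans (normc_lim_series_le _))//.
by apply: lee_nneseries => k *; rewrite ?lee_fin ?normc_ge0// Normc.normcM normc_conj.
Qed.

Lemma ip_norm_le x y :
  normc (ip x y) <= (ell2_norm x ^+ 2 + ell2_norm y ^+ 2) / 2.
Proof. by rewrite -lee_fin (le_trans _ (ip_abs_le _ _))// normc_lim_series_le. Qed.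

Lemma ip_unique x y (l : C) :
  series (fun k => x k * (y k)^* ) @ \oo --> l -> ip x y = l.
Proof. by move=> h; rewrite -(cvg_lim _ h). Qed.

Lemma ipDl x y z : ip (x + y) z = ip x z + ip y z.
Proof.
apply: ip_unique.
rewrite (_ : series _ = series (fun k => x k * (z k)^* ) + series (fun k => y k * (z k)^* )).
  by apply: cvgD; exact: ip_cvg.
by apply/funext => n; rewrite /series/= !fctE -big_split/=; apply: eq_bigr => i _; rewrite mulrDl.
Qed.

Lemma ipZl (a : C) x y : ip (a *: x) y = a * ip x y.
Proof.
apply: ip_unique.
rewrite (_ : series _ = fun n => a * series (fun k => x k * (y k)^* ) n).
  by apply: cvgMr; exact: ip_cvg.
by apply/funext => n; rewrite /series/= big_distrr/=; apply: eq_bigr => i _; rewrite mulrA.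
Qed.

Lemma ipC x y : ip y x = (ip x y)^*.
Proof.
apply: ip_unique; apply: cvg_complex.
  rewrite complexReJ (_ : (fun n => _) = (fun n => complex.Re (series (fun k => x k * (y k)^* ) n))).
    by apply: cvg_Re; exact: ip_cvg.
  apply/funext => n; rewrite /series/= !complexRe_sum; apply: eq_bigr => i _.
  by rewrite !complexReM !complexReJ !complexImJ; ring.
rewrite complexImJ (_ : (fun n => _) = (fun n => - complex.Im (series (fun k => x k * (y k)^* ) n))).
  by apply: cvgN; apply: cvg_Im; exact: ip_cvg.
apply/funext => n; rewrite /series/= !complexIm_sum -sumrN; apply: eq_bigr => i _.
by rewrite !complexImM !complexReJ !complexImJ; ring.
Qed.

Lemma ip_self x : ip x x = (ell2_norm x ^+ 2)%:C%C.
Proof.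
apply: ip_unique; apply: cvg_complex => /=; last first.
  rewrite (_ : (fun n => _) = (fun=> 0)); first exact: cvg_cst.
  apply/funext => n; rewrite /series/= !complexIm_sum big1// => i _.
  by rewrite !complexImM !complexReJ !complexImJ; ring.
rewrite (_ : (fun n => _) = series (fun k => normc (x k) ^+ 2)); last first.
  apply/funext => n; rewrite /series/= !complexRe_sum; apply: eq_bigr => i _.
  by rewrite complexReM complexReJ complexImJ sqr_normc; ring.
have : (fun n => \sum_(0 <= k < n) (normc (x k) ^+ 2)%:E)%E @ \oo --> (ell2_norm x ^+ 2)%:E.
  rewrite ell2_norm_sqr; apply: is_cvg_nneseries => k *; by rewrite lee_fin sqr_ge0.
move=> /fine_cvgP[_]; apply: cvg_trans; apply: near_eq_cvg; near=> n.
by rewrite /= sumEFin.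
Unshelve. all: by end_near. Qed.

End ell2_theory.

(** * Measurability and continuity of complex functions *)

Section complex_functions.
Variables (R : realType) (n : nat).
Local Notation C := R[i].
Local Notation Cn := 'rV[C]_n.
Variables (Om : set Cn) (Oo : open Om).
Local Notation D := (Om : set (borelC R n)).

Lemma measurable_open (U : set Cn) : open U -> measurable (U : set (borelC R n)).
Proof. by move=> Uo; apply: sub_sigma_algebra. Qed.
Let mD : measurable D := measurable_open Oo.

Lemma measurable_cfun_normc (f : Cn -> C) :
  measurable_cfun Om f -> measurable_fun D (fun z => normc (f z)).
Proof.
move=> [mr mi].
apply: (@eq_measurable_fun _ _ _ _ D (fun z =>
   (complex.Re (f z) ^+ 2 + complex.Im (f z) ^+ 2) `^ (2^-1))).
  by move=> z _ /=; rewrite powR12_sqrt ?addr_ge0 ?sqr_ge0//; case: (f z).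
apply: (measurableT_comp (measurable_powR _)).
by apply: measurable_funD; apply: measurable_funX.
Qed.

Lemma measurable_cfunD (f g : Cn -> C) : measurable_cfun Om f ->
  measurable_cfun Om g -> measurable_cfun Om (fun z => f z + g z).
Proof.
move=> [? ?] [? ?]; split.
  by under eq_fun do rewrite complexReD; exact: measurable_funD.
by under eq_fun do rewrite complexImD; exact: measurable_funD.
Qed.

Lemma measurable_cfunM (f g : Cn -> C) : measurable_cfun Om f ->
  measurable_cfun Om g -> measurable_cfun Om (fun z => f z * g z).
Proof.
move=> [? ?] [? ?]; split.
  by under eq_fun do rewrite complexReM; apply: measurable_funB; exact: measurable_funM.
by under eq_fun do rewrite complexImM; apply: measurable_funD; exact: measurable_funM.
Qed.

Lemma measurable_cfunJ (f : Cn -> C) : measurable_cfun Om f ->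
  measurable_cfun Om (fun z => (f z)^*).
Proof.
move=> [? ?]; split; first by under eq_fun do rewrite complexReJ.
under eq_fun do rewrite complexImJ; exact: measurableT_comp.
Qed.

Lemma measurable_cfun_cst (c : C) : measurable_cfun Om (fun=> c).
Proof. by split; exact: measurable_cst. Qed.

Lemma measurable_cfun_sum m (f : nat -> Cn -> C) :
  (forall k, measurable_cfun Om (f k)) ->
  measurable_cfun Om (fun z => \sum_(0 <= k < m) f k z).
Proof.
move=> mf; elim: m => [|m ih].
  by under eq_fun do rewrite big_geq//; exact: measurable_cfun_cst.
by under eq_fun do rewrite big_nat_recr//=; exact: measurable_cfunD.
Qed.

Lemma measurable_cfun_cvg (f : nat -> Cn -> C) (g : Cn -> C) :
  (forall k, measurable_cfun Om (f k)) ->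
  (forall z, Om z -> (fun k => f k z) @ \oo --> g z) -> measurable_cfun Om g.
Proof.
move=> mf fg; split.
  apply: (@measurable_fun_cvg _ _ _ _ (fun k (z : borelC R n) => complex.Re (f k z))).
    by move=> k; have [] := mf k.
  by move=> z Oz; exact: (cvg_Re (fg z Oz)).
apply: (@measurable_fun_cvg _ _ _ _ (fun k (z : borelC R n) => complex.Im (f k z))).
  by move=> k; have [] := mf k.
by move=> z Oz; exact: (cvg_Im (fg z Oz)).
Qed.

Lemma measurable_cfun_eq (f g : Cn -> C) : (forall z, Om z -> f z = g z) ->
  measurable_cfun Om f -> measurable_cfun Om g.
Proof.
move=> fg [mr mi]; split.
  by apply: eq_measurable_fun mr => z /set_mem Oz; rewrite fg.
by apply: eq_measurable_fun mi => z /set_mem Oz; rewrite fg.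
Qed.

Lemma continuous_on_open_preimage (V : topologicalType) (f : Cn -> V) (U : set V) :
  (forall z, Om z -> {for z, continuous f}) -> open U -> open (Om `&` f @^-1` U).
Proof.
move=> cf Uo; rewrite openE => z [Oz Uz]; apply: filterI.
  by move: Oo; rewrite openE; apply.
by apply: cf => //; move: Uo; rewrite openE; apply.
Qed.

Lemma measurable_continuous_on (f : Cn -> R) :
  (forall z, Om z -> {for z, continuous f}) -> measurable_fun D f.
Proof.
move=> cf; apply: (measurability _ (measurable_realfun.RGenOpens.measurableE R)).
move=> _ [_ [a [b ->]] <-]; apply: measurable_open.
by apply: continuous_on_open_preimage => //; exact: interval_open.
Qed.

Lemma measurable_map_on (f : Cn -> Cn) :
  (forall z, Om z -> {for z, continuous f}) ->
  measurable_fun D (f : borelC R n -> borelC R n).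
Proof.
move=> cf; apply: (@measurability _ _ (borelC R n) (borelC R n) D f (@open Cn)) => //.
move=> _ [U oU <-]; apply: measurable_open.
exact: continuous_on_open_preimage.
Qed.

Lemma near_normc_lt (x : C) (e : R) : 0 < e ->
  \forall y \near nbhs x, normc (x - y) < e.
Proof.
move=> e0; have e0' : 0 < e%:C%C by rewrite ltcR.
have := @cvgr_dist_lt _ _ _ (nbhs x) (nbhs_filter x) id x (@cvg_id _ _) _ e0'.
by apply: filterS => y /=; rewrite normr_normcE ltcR.
Qed.

Lemma continuous_normc (x : C) : {for x, continuous (@normc R : C -> R)}.
Proof.
apply/(cvgrPdist_lt (FF := nbhs_filter x)) => e /(near_normc_lt x).
apply: filterS => y; apply: le_lt_trans.
rewrite ler_norml; apply/andP; split.
  rewrite lerNl opprB lerBlDr -[normc (x - y)]normcN.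
  by rewrite (_ : normc y = normc (- (x - y) + x)) ?le_normcD// opprB subrK.
by rewrite lerBlDr {1}(_ : x = (x - y) + y) ?le_normcD// subrK.
Qed.

Lemma analytic_continuous (f : Cn -> C) z :
  analytic Om f -> Om z -> {for z, continuous f}.
Proof. by move=> h Oz; apply: differentiable_continuous; exact: h. Qed.

End complex_functions.

(** * Integrals of complex functions *)

Section complex_integrals.
Variables (R : realType) (n : nat).
Local Notation C := R[i].
Local Notation Cn := 'rV[C]_n.
Variables (Om : set Cn) (Oo : open Om).
Variable sigma : {measure set (borelC R n) -> \bar R}.
Local Notation D := (Om : set (borelC R n)).
Let mD : measurable D := measurable_open Oo.

(** The norms of the function spaces are those of extensions by zero; their
    powers are integrals over the domain. *)
Lemma Lnorm_patch_powR (h : Cn -> R) (p : R) : p != 0 ->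
  (forall z, 0 <= h z) ->
  ('N[sigma]_(p%:E)[((fun z => (h z)%:E) \_ Om)] `^ p =
   \int[sigma]_(z in D) (h z `^ p)%:E)%E.
Proof.
move=> p0 h0; rewrite poweR_Lnorm// [RHS]integral_mkcond.
apply: eq_integral => z _; rewrite /patch; case: ifP => _.
  by rewrite gee0_abs ?lee_fin// poweR_EFin.
by rewrite abse0 poweR_EFin powR0.
Qed.

Lemma Lnorm_patch2 (h : Cn -> R) : (forall z, 0 <= h z) ->
  ('N[sigma]_(2%:E)[((fun z => (h z)%:E) \_ Om)] `^ 2 =
   \int[sigma]_(z in D) (h z ^+ 2)%:E)%E.
Proof.
move=> h0; rewrite Lnorm_patch_powR ?pnatr_eq0//.
by apply: eq_integral => z _; rewrite powR_mulrn.
Qed.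

Lemma Lnorm_patch2_fin (h : Cn -> R) : (forall z, 0 <= h z) ->
  ('N[sigma]_(2%:E)[((fun z => (h z)%:E) \_ Om)] < +oo)%E <->
  (\int[sigma]_(z in D) (h z ^+ 2)%:E < +oo)%E.
Proof.
move=> h0; rewrite -Lnorm_patch2//.
have := Lnorm_ge0 sigma 2%:E ((fun z => (h z)%:E) \_ Om).
case: ('N[sigma]_(2%:E)[_])%E => [r||]//= r0; first by rewrite !ltry.
by rewrite pnatr_eq0 ltxx.
Qed.

Lemma Lnorm_patch2_sqr (h : Cn -> R) : (forall z, 0 <= h z) ->
  ('N[sigma]_(2%:E)[((fun z => (h z)%:E) \_ Om)] < +oo)%E ->
  ((fine 'N[sigma]_(2%:E)[((fun z => (h z)%:E) \_ Om)]) ^+ 2)%:E =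
  (\int[sigma]_(z in D) (h z ^+ 2)%:E)%E.
Proof.
move=> h0; rewrite -Lnorm_patch2//.
have := Lnorm_ge0 sigma 2%:E ((fun z => (h z)%:E) \_ Om).
case: ('N[sigma]_(2%:E)[_])%E => [r||]//= r0 _.
by rewrite -powR_mulrn.
Qed.

Definition integrableC (f : Cn -> C) := measurable_cfun Om f /\
  (\int[sigma]_(z in D) (normc (f z))%:E < +oo)%E.

Lemma integrableC_Re f : integrableC f -> sigma.-integrable D (EFin \o (fun z => complex.Re (f z))).
Proof.
move=> [mf fi]; apply/integrableP; split; first by apply/measurable_EFinP; case: mf.
apply: le_lt_trans fi; apply: ge0_le_integral => //.
- by apply/measurable_EFinP; apply: measurableT_comp => //; case: mf.
- by apply/measurable_EFinP; exact: measurable_cfun_normc.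
- by move=> z _; rewrite lee_fin normr_Re_le.
Qed.

Lemma integrableC_Im f : integrableC f -> sigma.-integrable D (EFin \o (fun z => complex.Im (f z))).
Proof.
move=> [mf fi]; apply/integrableP; split; first by apply/measurable_EFinP; case: mf.
apply: le_lt_trans fi; apply: ge0_le_integral => //.
- by apply/measurable_EFinP; apply: measurableT_comp => //; case: mf.
- by apply/measurable_EFinP; exact: measurable_cfun_normc.
- by move=> z _; rewrite lee_fin normr_Im_le.
Qed.

Lemma integrableCZ c f : integrableC f -> integrableC (fun z => c * f z).
Proof.
move=> [mf fi]; split.
  by apply: measurable_cfunM => //; exact: measurable_cfun_cst.
under eq_integral do rewrite Normc.normcM EFinM.
rewrite ge0_integralZl//; last 3 first.
- by apply/measurable_EFinP; exact: measurable_cfun_normc.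
- by move=> z _; rewrite lee_fin normc_ge0.
- by rewrite lee_fin normc_ge0.
have : (0 <= \int[sigma]_(z in D) (normc (f z))%:E)%E.
  by apply: integral_ge0 => z _; rewrite lee_fin normc_ge0.
by case: (\int[_]_(_ in _) _)%E fi => [r||]// _ _; rewrite -EFinM ltry.
Qed.

Lemma integrableC_le f (h : Cn -> \bar R) : measurable_cfun Om f ->
  measurable_fun D h -> (forall z, Om z -> ((normc (f z))%:E <= h z)%E) ->
  (\int[sigma]_(z in D) h z < +oo)%E -> integrableC f.
Proof.
move=> mf mh fh hi; split => //; apply: le_lt_trans hi; apply: ge0_le_integral => //.
- by move=> z _; rewrite lee_fin normc_ge0.
- by apply/measurable_EFinP; exact: measurable_cfun_normc.
Qed.

Local Notation I := (integralC Om sigma).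

Lemma integralC_eq f g : (forall z, Om z -> f z = g z) -> I f = I g.
Proof.
move=> fg; rewrite /integralC /Rintegral; congr (Complex (fine _) (fine _)).
  by apply: eq_integral => z /set_mem/fg ->.
by apply: eq_integral => z /set_mem/fg ->.
Qed.

Lemma integralCD f g : integrableC f -> integrableC g -> I (fun z => f z + g z) = I f + I g.
Proof.
move=> fi gi; apply: complex_ext; rewrite /integralC/=.
  under eq_Rintegral do rewrite complexReD.
  by rewrite RintegralD//; exact: integrableC_Re.
under eq_Rintegral do rewrite complexImD.
by rewrite RintegralD//; exact: integrableC_Im.
Qed.

Lemma integralCZ c f : integrableC f -> I (fun z => c * f z) = c * I f.
Proof.
have Z (r : R) h : sigma.-integrable D (EFin \o h) ->
  sigma.-integrable D (EFin \o (fun z => r * h z)) by exact: integrableZl.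
move=> fi; apply: complex_ext; rewrite /integralC ?complexReM ?complexImM/=.
  under eq_Rintegral do rewrite complexReM.
  rewrite RintegralB//; last 2 first.
  - by apply: Z; exact: integrableC_Re.
  - by apply: Z; exact: integrableC_Im.
  by rewrite !RintegralZl//; [exact: integrableC_Im|exact: integrableC_Re].
under eq_Rintegral do rewrite complexImM.
rewrite RintegralD//; last 2 first.
- by apply: Z; exact: integrableC_Im.
- by apply: Z; exact: integrableC_Re.
by rewrite !RintegralZl//; [exact: integrableC_Re|exact: integrableC_Im].
Qed.

Lemma integralC_conj f : integrableC f -> I (fun z => (f z)^*) = (I f)^*.
Proof.
move=> fi; apply: complex_ext; rewrite ?complexReJ ?complexImJ /integralC/=.
  by under eq_Rintegral do rewrite complexReJ.
under eq_Rintegral do rewrite complexImJ -mulN1r.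
by rewrite RintegralZl ?mulN1r//; exact: integrableC_Im.
Qed.

(** Rotating the integral onto the positive axis reduces the bound to the real
    case. *)
Lemma normc_integralC_le f : integrableC f ->
  ((normc (I f))%:E <= \int[sigma]_(z in D) (normc (f z))%:E)%E.
Proof.
move=> fi; have [I0|I0] := eqVneq (normc (I f)) 0.
  by rewrite I0; apply: integral_ge0 => z _; rewrite lee_fin normc_ge0.
pose c := (I f)^* / (normc (I f))%:C%C.
have nc : normc c = 1.
  rewrite /c Normc.normcM Normc.normcV normc_conj.
  by rewrite /normc/= expr0n addr0 sqrtr_sqr ger0_norm ?normc_ge0 ?divff.
have cI : c * I f = (normc (I f))%:C%C.
  rewrite /c mulrAC [X in X / _](_ : _ = (normc (I f) ^+ 2)%:C%C).
    by rewrite expr2 rmorphM/= mulfK// eq_complex/= (negbTE I0).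
  by apply: complex_ext; rewrite ?complexReM ?complexImM !complexReJ !complexImJ ?sqr_normc/=; ring.
have cf := integrableCZ c fi.
have -> : normc (I f) = \int[sigma]_(z in D) complex.Re (c * f z).
  by have := congr1 (@complex.Re R) cI; rewrite -integralCZ.
have intf := integrableC_Re cf.
rewrite /Rintegral fineK ?integrable_fin_num//.
have := le_abse_integral sigma mD (measurable_int _ intf).
move=> h; apply: (le_trans (lee_abs _)); apply: (le_trans h).
have [mcf _] := cf; have [mf _] := fi.
apply: ge0_le_integral => //.
- by apply/measurable_EFinP; apply: measurableT_comp => //; case: mcf.
- by apply/measurable_EFinP; exact: measurable_cfun_normc.
- by move=> z _; rewrite lee_fin (le_trans (normr_Re_le _))// Normc.normcM nc mul1r.
Qed.

End complex_integrals.

(** * Representation of functionals on a complete subspace *)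

Section riesz.
Variable R : realType.

(** The best [s] is [sqrt b / sqrt a]; by homogeneity this turns bounds by sums
    of squares into bounds of Cauchy-Schwarz type. *)
Lemma optimize_scale (x a b : R) : 0 <= a -> 0 <= b ->
  (forall s, 0 < s -> x <= s * a + b / s) -> x <= 2 * (Num.sqrt a * Num.sqrt b).
Proof.
move=> a0 b0 h.
have small (y c : R) : 0 <= c -> (forall s, 0 < s -> y <= s * c) -> y <= 0.
  move=> c0 hy; rewrite leNgt; apply/negP => y0.
  have s0 : 0 < y / (2 * (c + 1)) by rewrite divr_gt0// mulr_gt0// ltr_wpDl.
  have := hy _ s0; apply/negP; rewrite -ltNge.
  rewrite mulrAC ltr_pdivrMr; last by rewrite mulr_gt0// ltr_wpDl.
  nra.
have [a1|a1] := eqVneq a 0.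
  rewrite a1 sqrtr0 mul0r mulr0; apply: (small _ b) => // s s0.
  have := h s^-1; rewrite invr_gt0 => /(_ s0); rewrite a1 mulr0 add0r invrK mulrC.
  by rewrite mulrC.
have [b1|b1] := eqVneq b 0.
  rewrite b1 sqrtr0 mulr0 mulr0; apply: (small _ a) => // s s0.
  by have := h s s0; rewrite b1 mul0r addr0.
have sa : 0 < Num.sqrt a by rewrite sqrtr_gt0 lt_def a1.
have sb : 0 < Num.sqrt b by rewrite sqrtr_gt0 lt_def b1.
have := h (Num.sqrt b / Num.sqrt a) (divr_gt0 sb sa).
have {2}-> : a = Num.sqrt a ^+ 2 by rewrite sqr_sqrtr.
have {2}-> : b = Num.sqrt b ^+ 2 by rewrite sqr_sqrtr.
move=> /le_trans; apply; rewrite le_eqVlt; apply/orP; left; apply/eqP; field.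
by rewrite !gt_eqF.
Qed.

Variables (V : lmodType R[i]) (B : set V) (b : V -> V -> R) (nrm : V -> \bar R).
Hypothesis B0 : B 0.
Hypothesis BD : forall (a : R) f g, B f -> B g -> B (f + a%:C%C *: g).
Hypothesis bD : forall (a : R) f g h, B f -> B g -> B h ->
  b (f + a%:C%C *: g) h = b f h + a * b g h.
Hypothesis bC : forall f g, B f -> B g -> b f g = b g f.
Hypothesis b_ge0 : forall f, B f -> 0 <= b f f.
Hypothesis nrmE : forall f, B f -> nrm f = (Num.sqrt (b f f))%:E.
Hypothesis Bcomplete : complete_subspace B nrm.

Let bsqr (a : R) f g : B f -> B g ->
  b (f + a%:C%C *: g) (f + a%:C%C *: g) = b f f + 2 * a * b f g + a ^+ 2 * b g g.
Proof.
move=> Bf Bg; have Bfg := BD a Bf Bg.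
rewrite bD// [b f _]bC// [b g (_ + _)]bC// !bD// [b g f]bC//; ring.
Qed.

Let subE (f g : V) : f - g = f + (-1)%:C%C *: g.
Proof. by rewrite rmorphN1 scaleN1r. Qed.

(** The form [b] is real-valued and real-bilinear: it stands for the real part of
    an inner product, and its null vectors need not vanish. *)
Lemma riesz_cauchy_schwarz f g : B f -> B g ->
  `|b f g| <= Num.sqrt (b f f) * Num.sqrt (b g g).
Proof.
move=> Bf Bg.
have cs c : c = 1 \/ c = -1 -> c * b f g <= Num.sqrt (b f f) * Num.sqrt (b g g).
  move=> hc; rewrite -(ler_pM2l (ltr0n _ 2)); apply: optimize_scale => //; try exact: b_ge0.
  move=> s s0; have := b_ge0 (BD (- c / s) Bf Bg); rewrite bsqr//.
  have c2 : c ^+ 2 = 1 by case: hc => ->; rewrite ?sqrrN expr1n.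
  rewrite -(pmulr_rge0 _ s0) exprMn sqrrN c2 mul1r -[_ <= s * _ + _]subr_ge0.
  have -> : s * (b f f + 2 * (- c / s) * b f g + s^-1 ^+ 2 * b g g) =
    s * b f f + b g g / s - 2 * (c * b f g) by field; exact: lt0r_neq0.
  by [].
by rewrite ler_norml; have := cs 1; have := cs (-1); rewrite mul1r mulN1r => h1 h2;
   rewrite lerNl h1 ?h2//; [left|right].
Qed.

(** A minimizer of [b f f - 2 L f] represents [L] by the first variation.  It
    exists because the parallelogram law makes minimizing sequences Cauchy. *)
Lemma riesz_representation (L : V -> R) (M : R) :
  (forall (a : R) f g, B f -> B g -> L (f + a%:C%C *: g) = L f + a * L g) ->
  (forall f, B f -> `|L f| <= M * Num.sqrt (b f f)) ->
  exists2 g, B g & forall h, B h -> b g h = L h.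
Proof.
move=> LD Lb.
pose J f := b f f - 2 * L f.
pose S := [set J f | f in B].
have SJ f : B f -> S (J f) by exists f.
have lbS : lbound S (- M ^+ 2).
  move=> _ [f Bf <-]; rewrite /J.
  have := Lb f Bf; rewrite ler_norml => /andP[_].
  have := sqr_ge0 (Num.sqrt (b f f) - M).
  have := sqr_sqrtr (b_ge0 Bf); nra.
have S0 : S !=set0 by exists (J 0); exact: SJ.
have hS : has_inf S by split => //; exists (- M ^+ 2).
pose d := inf S.
have dle f : B f -> d <= J f by move=> Bf; apply: ge_inf; [case: hS|exact: SJ].
have /choice [u uP] : forall i : nat, exists f, B f /\ J f < d + i.+1%:R^-1.
  move=> i; have e0 : 0 < i.+1%:R^-1 :> R by rewrite invr_gt0.
  have [_ [f Bf <-] lf] := inf_adherent e0 hS; by exists f.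
have Bu i : B (u i) by case: (uP i).
have Ju i : J (u i) < d + i.+1%:R^-1 by case: (uP i).
have inv_small (e : R) : 0 < e -> exists N : nat, forall i, (N <= i)%N -> i.+1%:R^-1 < e.
  move=> e0; have [N hN] := ltr_add_invr (y := 0) (x := e) e0.
  exists N => i Ni; rewrite add0r in hN; apply: le_lt_trans hN.
  by rewrite lef_pV2 ?posrE// ler_nat ltnS.
(* The parallelogram law, with [d <= J] at the midpoint of [f] and [g]. *)
have dist f g : B f -> B g -> b (f - g) (f - g) <= 2 * (J f - d) + 2 * (J g - d).
  move=> Bf Bg; have Bm := BD 1 Bf Bg.
  have := dle _ (BD (2^-1 - 1) Bm Bm).
  have Bfg := BD (-1) Bf Bg.
  rewrite subE bsqr// /J LD// !bsqr// !LD//.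
  lra.
have [] := @Bcomplete u Bu.
  move=> e e0; have e20 : 0 < e ^+ 2 / 4 by rewrite divr_gt0// exprn_gt0.
  have [N hN] := inv_small _ e20.
  exists N => i j Ni Nj; have Bij : B (u i - u j) by rewrite subE; exact: BD.
  rewrite nrmE// lte_fin -[ltRHS]ger0_norm ?(ltW e0)// -sqrtr_sqr ltr_sqrt ?exprn_gt0//.
  apply: (le_lt_trans (dist _ _ (Bu i) (Bu j))).
  have ai : J (u i) < d + e ^+ 2 / 4 by rewrite (lt_trans (Ju i))// ltrD2l hN.
  have aj : J (u j) < d + e ^+ 2 / 4 by rewrite (lt_trans (Ju j))// ltrD2l hN.
  lra.
move=> g Bg gu; exists g => // h Bh.
(* The first variation at [g] in the direction [h], as a limit of those at [u i],
   where [J] is within [1 / (i + 1)] of its infimum. *)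
have key t : 0 <= t ^+ 2 * b h h + 2 * t * (b g h - L h).
  apply/ler_addgt0Pr => e e0; rewrite -lerBlDr.
  pose c := 2 * `|t| * (Num.sqrt (b h h) + 1).
  have c0 : 0 <= c by rewrite !mulr_ge0// addr_ge0// sqrtr_ge0.
  have e1 : 0 < e / 2 by rewrite divr_gt0.
  have e2 : 0 < e / (2 * (c + 1)) by rewrite divr_gt0// mulr_gt0// ltr_wpDl.
  have [N1 h1] := inv_small _ e1.
  have [N2 h2] := gu _ e2.
  pose i := maxn N1 N2.
  have Bi : B (u i - g) by rewrite subE; exact: BD.
  have := h2 i (leq_maxr _ _); rewrite nrmE// lte_fin => h3.
  have := h1 i (leq_maxl _ _) => h4.
  have := riesz_cauchy_schwarz Bi Bh.
  have -> : b (u i - g) h = b (u i) h - b g h by rewrite subE bD// mulN1r.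
  move=> cs; have := dle _ (BD t (Bu i) Bh); rewrite /J bsqr// LD//.
  have := Ju i; rewrite /J => /lt_trans/(_ (_ : _ < d + e / 2)); rewrite ltrD2l => /(_ h4) j1 j2.
  have cc : `|2 * t * (b (u i) h - b g h)| <= e / 2.
    rewrite !normrM ger0_norm//.
    apply: (@le_trans _ _ (c * Num.sqrt (b (u i - g) (u i - g)))).
      rewrite /c -!mulrA ler_wpM2l// ler_wpM2l//; apply: (le_trans cs).
      by rewrite mulrC ler_wpM2r ?sqrtr_ge0// lerDl.
    apply: (@le_trans _ _ (c * (e / (2 * (c + 1))))).
      by rewrite ler_wpM2l// ltW.
    rewrite invfM !mulrA ler_pdivrMr ?ltr_wpDl//.
    rewrite mulrAC; have : 0 <= e * c by rewrite mulr_ge0// ltW.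
    nra.
  move: cc; rewrite ler_norml => /andP[_ cc]; lra.
have ub c : (forall t, 0 <= t ^+ 2 * b h h + 2 * t * c) -> 0 <= c.
  move=> hc; rewrite leNgt; apply/negP => c0.
  have bh1 : 0 < b h h + 1 by rewrite ltr_wpDl// b_ge0.
  have := hc (- c / (b h h + 1)); apply/negP; rewrite -ltNge.
  rewrite (_ : _ + _ = - (c / (b h h + 1)) ^+ 2 * (b h h + 2)); last first.
    by field; exact: lt0r_neq0.
  rewrite mulNr oppr_lt0 mulr_gt0// ?ltr_wpDl ?b_ge0//.
  by rewrite exprn_even_gt0//= mulf_neq0 ?invr_neq0// ?(lt_eqF c0)// (gt_eqF bh1).
apply/eqP; rewrite -subr_eq0 eq_le; apply/andP; split; last exact: ub key.
rewrite -oppr_ge0; apply: ub => t; have := key (- t).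
by rewrite sqrrN (mulrN 2) mulNr -mulrN.
Qed.

End riesz.

(** * Square-integrable functions *)

Section scalar_L2.
Variables (R : realType) (n : nat).
Local Notation C := R[i].
Local Notation Cn := 'rV[C]_n.
Variables (Om : set Cn) (Oo : open Om).
Variable sigma : {measure set (borelC R n) -> \bar R}.
Local Notation D := (Om : set (borelC R n)).
Let mD : measurable D := measurable_open Oo.
Implicit Types f g : Cn -> C.

Lemma L2P f : L2 Om sigma f <-> measurable_cfun Om f /\
  (\int[sigma]_(z in D) (normc (f z) ^+ 2)%:E < +oo)%E.
Proof.
split=> -[mf]; rewrite /Lp_norm => /Lnorm_patch2_fin h; split => //.
  by apply: h => z; exact: normc_ge0.
by apply: h => z; exact: normc_ge0.
Qed.

Lemma normB_ge0 f : 0 <= normB Om sigma f.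
Proof. by apply: fine_ge0; exact: Lnorm_ge0. Qed.

Lemma normB_sqr f : L2 Om sigma f ->
  (normB Om sigma f ^+ 2)%:E = (\int[sigma]_(z in D) (normc (f z) ^+ 2)%:E)%E.
Proof. by move=> [_ lf]; rewrite Lnorm_patch2_sqr// => z; exact: normc_ge0. Qed.

Lemma measurable_sqr_normc f : measurable_cfun Om f ->
  measurable_fun D (fun z => (normc (f z) ^+ 2)%:E).
Proof.
by move=> mf; apply/measurable_EFinP; apply: measurable_funX; exact: measurable_cfun_normc.
Qed.

Lemma integral_normc_mul_le f g : L2 Om sigma f -> L2 Om sigma g ->
  (\int[sigma]_(z in D) (normc (f z) * normc (g z))%:E <=
   ((normB Om sigma f ^+ 2 + normB Om sigma g ^+ 2) / 2)%:E)%E.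
Proof.
move=> lf lg; have [mf _] := lf; have [mg _] := lg.
rewrite mulrC EFinM EFinD !normB_sqr// -ge0_integralD//; last 4 first.
- by move=> z _; rewrite lee_fin sqr_ge0.
- exact: measurable_sqr_normc.
- by move=> z _; rewrite lee_fin sqr_ge0.
- exact: measurable_sqr_normc.
rewrite -ge0_integralZl//; last 2 first.
- by apply: emeasurable_funD; exact: measurable_sqr_normc.
- by move=> z _; rewrite -EFinD lee_fin addr_ge0 ?sqr_ge0.
apply: ge0_le_integral => //.
- by move=> z _; rewrite lee_fin mulr_ge0 ?normc_ge0.
- by apply/measurable_EFinP; apply: measurable_funM; exact: measurable_cfun_normc.
- apply: emeasurable_funM => //; apply: emeasurable_funD; exact: measurable_sqr_normc.
- move=> z _; rewrite -EFinD -EFinM lee_fin.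
  by have := sqr_ge0 (normc (f z) - normc (g z)); lra.
Qed.

Lemma integrableC_mul_conj f g : L2 Om sigma f -> L2 Om sigma g ->
  integrableC Om sigma (fun z => f z * (g z)^*).
Proof.
move=> lf lg; split.
  by case: lf lg => mf _ [mg _]; apply: measurable_cfunM => //; exact: measurable_cfunJ.
under eq_integral do rewrite Normc.normcM normc_conj.
by rewrite (le_lt_trans (integral_normc_mul_le lf lg))// ltry.
Qed.

Lemma L2Z c f : L2 Om sigma f -> L2 Om sigma (fun z => c * f z).
Proof.
move=> /L2P[mf fi]; apply/L2P; split.
  by apply: measurable_cfunM => //; exact: measurable_cfun_cst.
under eq_integral do rewrite Normc.normcM exprMn EFinM.
rewrite ge0_integralZl//; last 3 first.
- exact: measurable_sqr_normc.
- by move=> z _; rewrite lee_fin sqr_ge0.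
- by rewrite lee_fin sqr_ge0.
have : (0 <= \int[sigma]_(z in D) (normc (f z) ^+ 2)%:E)%E.
  by apply: integral_ge0 => z _; rewrite lee_fin sqr_ge0.
by case: (\int[_]_(_ in _) _)%E fi => [r||]// _ _; rewrite -EFinM ltry.
Qed.

Lemma normBZ c f : L2 Om sigma f ->
  normB Om sigma (fun z => c * f z) = normc c * normB Om sigma f.
Proof.
move=> lf; have lcf := L2Z c lf; have [mf _] := lf.
apply/eqP; rewrite -(@eqrXn2 _ 2%N) ?normB_ge0 ?mulr_ge0 ?normc_ge0 ?normB_ge0//.
rewrite -eqe normB_sqr// exprMn EFinM normB_sqr// -ge0_integralZl//.
- by apply/eqP; apply: eq_integral => z _; rewrite Normc.normcM exprMn EFinM.
- exact: measurable_sqr_normc.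
- by move=> z _; rewrite lee_fin sqr_ge0.
- by rewrite lee_fin sqr_ge0.
Qed.

Lemma ipBZ c d f g : L2 Om sigma f -> L2 Om sigma g ->
  ipB Om sigma (fun z => c * f z) (fun z => d * g z) =
  c * d^* * ipB Om sigma f g.
Proof.
move=> lf lg; rewrite -integralCZ//; last exact: integrableC_mul_conj.
by apply: integralC_eq => z _; rewrite rmorphM/=; ring.
Qed.

Lemma ipB_conj f g : L2 Om sigma f -> L2 Om sigma g ->
  ipB Om sigma g f = (ipB Om sigma f g)^*.
Proof.
move=> lf lg; rewrite -integralC_conj//; last exact: integrableC_mul_conj.
by apply: integralC_eq => z _; rewrite rmorphM/= conjCK mulrC.
Qed.

Lemma ipB_self f : L2 Om sigma f -> ipB Om sigma f f = (normB Om sigma f ^+ 2)%:C%C.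
Proof.
move=> lf; apply: complex_ext => /=.
  apply: EFin_inj; rewrite normB_sqr// /Rintegral fineK; last first.
    by apply: integrable_fin_num => //; apply: integrableC_Re => //; exact: integrableC_mul_conj.
  by apply: eq_integral => z _; rewrite complexReM complexReJ complexImJ sqr_normc; congr EFin; ring.
rewrite /Rintegral (eq_integral (cst 0%E)) ?integral0// => z _ /=.
by rewrite complexImM complexReJ complexImJ; congr EFin; ring.
Qed.

Lemma ipB_le f g : L2 Om sigma f -> L2 Om sigma g ->
  normc (ipB Om sigma f g) <= (normB Om sigma f ^+ 2 + normB Om sigma g ^+ 2) / 2.
Proof.
move=> lf lg; rewrite -lee_fin; apply: le_trans (integral_normc_mul_le lf lg).
apply: le_trans (normc_integralC_le Oo (integrableC_mul_conj lf lg)) _.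
by under eq_integral do rewrite Normc.normcM normc_conj.
Qed.

End scalar_L2.

Section vector_L2.
Variables (R : realType) (n : nat).
Local Notation C := R[i].
Local Notation Cn := 'rV[C]_n.
Variables (Om : set Cn) (Oo : open Om).
Variable sigma : {measure set (borelC R n) -> \bar R}.
Local Notation D := (Om : set (borelC R n)).
Let mD : measurable D := measurable_open Oo.
Implicit Types f g h : Cn -> ell2 R.

Lemma measurable_l2P f : measurable_l2 Om f <->
  forall k, measurable_cfun Om (fun z => f z k).
Proof.
by split=> mf k; apply: measurable_cfun_eq (mf k) => z _; rewrite ip_basis.
Qed.

Lemma measurable_l2D (a : C) f g : measurable_l2 Om f -> measurable_l2 Om g ->
  measurable_l2 Om (a *: f + g).
Proof.
move=> mf mg k; rewrite /= (_ : (fun z => _) =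
    (fun z => a * ip (f z) (std_basis R k) + ip (g z) (std_basis R k))).
  apply: measurable_cfunD => //; apply: measurable_cfunM => //.
by apply/funext => z; rewrite !fctE ipDl ipZl.
Qed.

Lemma measurable_ip f g : measurable_l2 Om f -> measurable_l2 Om g ->
  measurable_cfun Om (fun z => ip (f z) (g z)).
Proof.
move=> /measurable_l2P mf /measurable_l2P mg.
apply: (@measurable_cfun_cvg _ _ _
   (fun m z => series (fun k => f z k * (g z k)^* ) m)).
  move=> m; apply: measurable_cfun_sum => k.
  by apply: measurable_cfunM => //; exact: measurable_cfunJ.
by move=> z _; exact: ip_cvg.
Qed.

Lemma measurable_ell2_norm2 f : measurable_l2 Om f ->
  measurable_fun D (fun z => (ell2_norm (f z) ^+ 2)%:E).
Proof.
move=> mf; have [m _] := measurable_ip mf mf.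
apply/measurable_EFinP; apply: eq_measurable_fun m => z _.
by rewrite ip_self.
Qed.

Lemma L2_l2P f : L2_l2 Om sigma f <-> measurable_l2 Om f /\
  (\int[sigma]_(z in D) (ell2_norm (f z) ^+ 2)%:E < +oo)%E.
Proof.
split=> -[mf]; rewrite /L2_norm_l2 => /Lnorm_patch2_fin h; split => //.
  by apply: h => z; exact: ell2_norm_ge0.
by apply: h => z; exact: ell2_norm_ge0.
Qed.

Lemma normB_l2_ge0 f : 0 <= normB_l2 Om sigma f.
Proof. by apply: fine_ge0; exact: Lnorm_ge0. Qed.

Lemma normB_l2_sqr f : L2_l2 Om sigma f ->
  (normB_l2 Om sigma f ^+ 2)%:E = (\int[sigma]_(z in D) (ell2_norm (f z) ^+ 2)%:E)%E.
Proof. by move=> [_ lf]; rewrite Lnorm_patch2_sqr// => z; exact: ell2_norm_ge0. Qed.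

Lemma ell2_norm2D (a : C) (x y : ell2 R) :
  ell2_norm (a *: x + y) ^+ 2 <=
  2 * normc a ^+ 2 * ell2_norm x ^+ 2 + 2 * ell2_norm y ^+ 2.
Proof.
rewrite -lee_fin EFinD (EFinM _ (ell2_norm x ^+ 2)) (EFinM 2 (ell2_norm y ^+ 2)).
rewrite !ell2_norm_sqr /sqsum.
rewrite -!nneseriesZl; last 2 first.
- by move=> k _; rewrite lee_fin sqr_ge0.
- by move=> k _; rewrite lee_fin sqr_ge0.
rewrite -nneseriesD; last 2 first.
- by move=> k *; rewrite mule_ge0// lee_fin ?sqr_ge0// mulr_ge0// sqr_ge0.
- by move=> k *; rewrite mule_ge0// lee_fin ?sqr_ge0// mulr_ge0// sqr_ge0.
apply: lee_nneseries => k *; first by rewrite lee_fin sqr_ge0.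
rewrite -!EFinM -EFinD lee_fin (le_trans (sqr_normcD_le _ _))//.
by rewrite Normc.normcM exprMn mulrA.
Qed.

Lemma L2_l2D (a : C) f g : L2_l2 Om sigma f -> L2_l2 Om sigma g ->
  L2_l2 Om sigma (a *: f + g).
Proof.
move=> /L2_l2P[mf fi] /L2_l2P[mg gi]; apply/L2_l2P; split.
  exact: measurable_l2D.
apply: (@le_lt_trans _ _ (\int[sigma]_(z in D)
   ((2 * normc a ^+ 2)%:E * (ell2_norm (f z) ^+ 2)%:E + 2%:E * (ell2_norm (g z) ^+ 2)%:E))%E).
  apply: ge0_le_integral => //.
  - by move=> z _; rewrite lee_fin sqr_ge0.
  - by apply: measurable_ell2_norm2; exact: measurable_l2D.
  - by apply: emeasurable_funD; apply: emeasurable_funM => //; exact: measurable_ell2_norm2.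
  - by move=> z _; rewrite -!EFinM -EFinD lee_fin !fctE; exact: ell2_norm2D.
have a0 : 0 <= 2 * normc a ^+ 2 by rewrite mulr_ge0 ?sqr_ge0.
rewrite ge0_integralD//; last 4 first.
- by move=> z _; rewrite -EFinM lee_fin mulr_ge0 ?sqr_ge0.
- by apply: emeasurable_funM => //; exact: measurable_ell2_norm2.
- by move=> z _; rewrite -EFinM lee_fin mulr_ge0 ?sqr_ge0.
- by apply: emeasurable_funM => //; exact: measurable_ell2_norm2.
rewrite !ge0_integralZl ?lee_fin//; last 4 first.
- exact: measurable_ell2_norm2.
- by move=> z _; rewrite lee_fin sqr_ge0.
- exact: measurable_ell2_norm2.
- by move=> z _; rewrite lee_fin sqr_ge0.
have h (r : R) f' : 0 <= r -> (\int[sigma]_(z in D) (ell2_norm (f' z) ^+ 2)%:E < +oo)%E ->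
   (r%:E * \int[sigma]_(z in D) (ell2_norm (f' z) ^+ 2)%:E < +oo)%E.
  have : (0 <= \int[sigma]_(z in D) (ell2_norm (f' z) ^+ 2)%:E)%E.
    by apply: integral_ge0 => z _; rewrite lee_fin sqr_ge0.
  by case: (\int[_]_(_ in _) _)%E => [s||]// _ _ _; rewrite -EFinM ltry.
by rewrite lte_add_pinfty// h.
Qed.

Lemma integrableC_ip f g : L2_l2 Om sigma f -> L2_l2 Om sigma g ->
  integrableC Om sigma (fun z => ip (f z) (g z)).
Proof.
move=> /L2_l2P[mf fi] /L2_l2P[mg gi].
apply: (@integrableC_le _ _ _ Oo _ _ (fun z => (ell2_norm (f z) ^+ 2)%:E + (ell2_norm (g z) ^+ 2)%:E)%E).
- exact: measurable_ip.
- by apply: emeasurable_funD; exact: measurable_ell2_norm2.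
- move=> z _; rewrite -EFinD lee_fin (le_trans (ip_norm_le _ _))//.
  by rewrite ler_pdivrMr// mulr2n mulrDr mulr1 lerDl addr_ge0 ?sqr_ge0.
- rewrite ge0_integralD//; last 4 first.
  + by move=> z _; rewrite lee_fin sqr_ge0.
  + exact: measurable_ell2_norm2.
  + by move=> z _; rewrite lee_fin sqr_ge0.
  + exact: measurable_ell2_norm2.
  exact: (lte_add_pinfty fi gi).
Qed.

Lemma ip_l2_conj f g : L2_l2 Om sigma f -> L2_l2 Om sigma g ->
  ip_l2 Om sigma g f = (ip_l2 Om sigma f g)^*.
Proof.
move=> lf lg; rewrite -integralC_conj//; last exact: integrableC_ip.
by apply: integralC_eq => z _; exact: ipC.
Qed.

Lemma ip_l2_self f : L2_l2 Om sigma f ->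
  complex.Re (ip_l2 Om sigma f f) = normB_l2 Om sigma f ^+ 2.
Proof.
move=> lf; apply: EFin_inj; rewrite normB_l2_sqr//= /Rintegral fineK; last first.
  by apply: integrable_fin_num => //; apply: integrableC_Re => //; exact: integrableC_ip.
by apply: eq_integral => z _; rewrite ip_self.
Qed.

Lemma bergman_l2D (a : C) f g : bergman_l2 Om sigma f -> bergman_l2 Om sigma g ->
  bergman_l2 Om sigma (a *: f + g).
Proof.
move=> [af lf] [ag lg]; split; last exact: L2_l2D.
move=> k z Oz; rewrite /= (_ : (fun z => _) =
    a *: (fun z => ip (f z) (std_basis R k)) + (fun z => ip (g z) (std_basis R k))).
  by apply: differentiableD; [apply: differentiableZ; exact: af|exact: ag].
by apply/funext => w; rewrite !fctE ipDl ipZl.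
Qed.

Lemma bergman_l2_0 : bergman_l2 Om sigma 0.
Proof.
split.
  move=> k z _; rewrite (_ : (fun z => _) = cst 0); first exact: differentiable_cst.
  by apply/funext => w; rewrite ip_basis.
apply/L2_l2P; split.
  by apply/measurable_l2P => k; exact: measurable_cfun_cst.
have n0 : ell2_norm (0 : ell2 R) = 0.
  rewrite /ell2_norm eseries0 ?sqrtr0// => k _ _; by rewrite Normc.normc0 expr0n.
rewrite (eq_integral (cst 0%E)) ?integral0// => z _.
by rewrite [(0 : Cn -> ell2 R) z]/(0 : ell2 R) n0 expr0n.
Qed.

Lemma L2_coordinate f k : L2_l2 Om sigma f -> L2 Om sigma (fun z => f z k).
Proof.
move=> /L2_l2P[mf fi]; apply/L2P => //; split; first by move/measurable_l2P : mf.
apply: le_lt_trans fi; apply: ge0_le_integral => //.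
- by move=> z _; rewrite lee_fin sqr_ge0.
- by apply: measurable_sqr_normc; move/measurable_l2P : mf.
- exact: measurable_ell2_norm2.
- move=> z _; rewrite ell2_norm_sqr /sqsum.
  have h i : (0 <= (normc (f z i) ^+ 2)%:E)%E by rewrite lee_fin sqr_ge0.
  apply: (le_trans _ (nneseries_lim_ge k.+1 (P := xpredT) (m := 0%N) (fun i _ _ => h i))).
  by rewrite big_nat_recr//= leeDr// sume_ge0.
Qed.

Lemma bergmanC_coordinate f k : bergman_l2 Om sigma f ->
  bergmanC Om sigma (fun z => f z k).
Proof.
move=> [af lf]; split; last exact: L2_coordinate.
by have := af k; rewrite (_ : (fun z => ip _ _) = (fun z => f z k))//;
   apply/funext => z; rewrite ip_basis.
Qed.

Lemma normB_coordinates f : L2_l2 Om sigma f ->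
  ((normB_l2 Om sigma f ^+ 2)%:E =
   \sum_(0 <= k <oo) (normB Om sigma (fun z => f z k) ^+ 2)%:E)%E.
Proof.
move=> lf; rewrite normB_l2_sqr//; have [/measurable_l2P mf _] := lf.
under eq_integral do rewrite ell2_norm_sqr /sqsum.
rewrite integral_nneseries//.
- by apply: eq_eseriesr => k _; rewrite normB_sqr//; exact: L2_coordinate.
- by move=> k; exact: measurable_sqr_normc.
- by move=> k z _; rewrite lee_fin sqr_ge0.
Qed.

Lemma scale_basisE (c : C) k i :
  ((c *: std_basis R k) : ell2 R) i = if i == k then c else 0.
Proof.
change (c * (i == k)%:R = if i == k then c else 0).
by case: eqP; rewrite ?mulr1 ?mulr0.
Qed.

Lemma ip_scale_basis (x : ell2 R) (c : C) k : ip x (c *: std_basis R k) = x k * c^*.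
Proof. by rewrite ipC ipZl ipC rmorphM/= conjCK ip_basis mulrC. Qed.

End vector_L2.

(** * Change of variables and Hölder's inequality *)

Section density_change_of_variables.
Context d (T : measurableType d) (R : realType).
Variables (mu : {measure set T -> \bar R}) (D : set T) (mD : measurable D).
Variable w : T -> R.
Hypothesis mw : measurable_fun D w.
Hypothesis w0 : forall x, 0 <= w x.
Import HBNNSimple.

Lemma integral_nnsfun_density (h : {nnsfun T >-> R}) (phi : T -> T) :
  measurable_fun D phi ->
  (\int[mu]_(x in D) ((h (phi x))%:E * (w x)%:E) =
   \sum_(y \in range h) (y%:E * \int[mu]_(x in D `&` phi @^-1` (h @^-1` [set y])) (w x)%:E))%E.
Proof.
move=> mphi.
pose A y := h @^-1` [set y].
have mA y : measurable (A y) by exact: measurable_sfunP.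
have mi y : measurable_fun D (fun x => ((\1_(A y) (phi x) : R) * w x)%:E).
  apply/measurable_EFinP; apply: measurable_funM => //.
  have m1 : measurable_fun setT (\1_(A y) : T -> R) by exact: measurable_indic.
  exact: (measurableT_comp m1 mphi).
have i0 y x : 0 <= (\1_(A y) (phi x) : R) * w x by rewrite mulr_ge0// indicE.
transitivity (\int[mu]_(x in D) (\sum_(y \in range h) y%:E * ((\1_(A y) (phi x) : R) * w x)%:E))%E.
  apply: eq_integral => x _; rewrite -EFinM [X in X * _]fimfunE.
  rewrite mulr_fsuml -fsumEFin//.
  by apply: eq_fsbigr => y _; rewrite -EFinM mulrA.
rewrite ge0_integral_fsum//; last 2 first.
- by move=> y; apply: emeasurable_funM.
- move=> y x _.
  have [y0|y0] := leP 0 y; first by rewrite mule_ge0// lee_fin.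
  by rewrite /A preimage_nnfun0// indic0 mul0r mule0.
apply: eq_fsbigr => y /set_mem[x _ hx].
have y0 : 0 <= y by rewrite -hx.
rewrite ge0_integralZl//; last by move=> z _; rewrite lee_fin.
congr (_ * _)%E; rewrite integral_mkcondr; apply: eq_integral => z _; rewrite /patch indicE.
rewrite (_ : (z \in phi @^-1` _) = (phi z \in A y)); last by apply/idP/idP; rewrite !inE.
by case: ifPn => _; rewrite ?mul1r ?mul0r.
Qed.

(** By monotone approximation both sides are determined by the integrals of [w]
    over the level sets of simple functions, where the invariance applies. *)
Lemma density_change_of_variables (phi : T -> T) (g : T -> \bar R) :
  measurable_fun D phi -> (forall x, D x -> D (phi x)) ->
  (forall E, E `<=` D -> measurable E ->
    (\int[mu]_(x in E) (w x)%:E = \int[mu]_(x in D `&` phi @^-1` E) (w x)%:E)%E) ->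
  measurable_fun D g -> (forall x, D x -> (0 <= g x)%E) ->
  (\int[mu]_(x in D) (g x * (w x)%:E) = \int[mu]_(x in D) (g (phi x) * (w x)%:E))%E.
Proof.
move=> mphi Dphi inv mg g0.
pose h := nnsfun_approx mD mg.
have lim (psi : T -> T) : measurable_fun D psi -> (forall x, D x -> D (psi x)) ->
  (\int[mu]_(x in D) (g (psi x) * (w x)%:E) =
   limn (fun n => \int[mu]_(x in D) ((h n (psi x))%:E * (w x)%:E)))%E.
  move=> mpsi Dpsi; rewrite -monotone_convergence//.
  - apply: eq_integral => x /set_mem Dx; apply/esym/cvg_lim => //.
    by apply: cvgeZr => //; exact: (cvg_nnsfun_approx mD mg g0 (Dpsi _ Dx)).
  - move=> n; apply: emeasurable_funM; last exact/measurable_EFinP.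
    apply/measurable_EFinP; exact: measurableT_comp.
  - by move=> n x _; rewrite mule_ge0// lee_fin.
  - move=> x _ m n mn; rewrite lee_wpmul2r ?lee_fin//.
    by have /lefP := nd_nnsfun_approx mD mg mn; apply.
have := lim id (@measurable_id _ _ D) (fun _ Dx => Dx); rewrite /= => ->.
rewrite lim//; congr (limn _); apply/funext => n.
rewrite (integral_nnsfun_density _ mphi) (integral_nnsfun_density _ (@measurable_id _ _ D)).
apply: eq_fsbigr => y _; congr (_ * _)%E.
have mE : measurable (D `&` id @^-1` (h n @^-1` [set y])).
  by apply: measurableI => //; exact: measurable_sfunP.
rewrite (inv _ _ mE); last by move=> x [].
by congr integral; apply/seteqP; split => x [Dx] /=; [move=> [_]|move=> hx; do 2 split => //; exact: Dphi].
Qed.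

End density_change_of_variables.

Section hoelder_on.
Context d (T : measurableType d) (R : realType).
Variables (mu : {measure set T -> \bar R}) (D : set T) (mD : measurable D).

Lemma hoelder_on (a b : T -> R) (p q : R) :
  measurable_fun D a -> measurable_fun D b ->
  (forall x, 0 <= a x) -> (forall x, 0 <= b x) ->
  0 < p -> 0 < q -> p^-1 + q^-1 = 1 ->
  (\int[mu]_(x in D) (a x * b x)%:E <=
   (\int[mu]_(x in D) (a x `^ p)%:E) `^ p^-1 *
   (\int[mu]_(x in D) (b x `^ q)%:E) `^ q^-1)%E.
Proof.
move=> ma mb a0 b0 p0 q0 pq.
have norm r (c : T -> R) : (forall x, 0 <= c x) -> 0 < r ->
   ('N[mu]_(r%:E)[EFin \o c \_ D])%E = ((\int[mu]_(x in D) (c x `^ r)%:E) `^ r^-1)%E.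
  move=> c0 r0; rewrite unlock [in RHS]integral_mkcond; congr (_ `^ _)%E.
  apply: eq_integral => x _; rewrite /= /patch; case: ifP => _.
    by rewrite ger0_norm// poweR_EFin.
  by rewrite normr0 powR0// gt_eqF.
have := @hoelder _ _ _ mu (a \_ D) (b \_ D) p q.
rewrite !norm//; move=> /(_ ((measurable_restrictT _ mD).1 ma) ((measurable_restrictT _ mD).1 mb) p0 q0 pq).
apply: le_trans; rewrite Lnorm1 integral_mkcond le_eqVlt; apply/orP; left; apply/eqP.
apply: eq_integral => x _; rewrite /= /patch; case: ifP => _.
  by rewrite ger0_norm// mulr_ge0.
by rewrite mulr0 normr0.
Qed.

End hoelder_on.

(** * Separately continuous functions *)

Section joint_measurability.
Variables (R : realType) (n : nat).
Local Notation C := R[i].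
Local Notation Cn := 'rV[C]_n.

Lemma complex_rational_dense (x : C) (e : R) : 0 < e ->
  exists q : rat * rat, normc (x - Complex (ratr q.1) (ratr q.2)) < e.
Proof.
move=> e0; have e2 : 0 < e / 2 by rewrite divr_gt0.
have [p] : exists p : rat, ratr p \in `](complex.Re x - e / 2), (complex.Re x + e / 2)[.
  by apply: rat_in_itvoo; lra.
have [q] : exists q : rat, ratr q \in `](complex.Im x - e / 2), (complex.Im x + e / 2)[.
  by apply: rat_in_itvoo; lra.
rewrite !in_itv/= => /andP[q1 q2] /andP[p1 p2]; exists (p, q) => /=.
rewrite (le_lt_trans (normc_le_ReIm _))//.
case: x p1 p2 q1 q2 => a b /= p1 p2 q1 q2.
rewrite [ltRHS]splitr ltrD// ltr_norml; apply/andP; split; lra.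
Qed.

Lemma rational_vectors_dense : exists s : nat -> Cn,
  forall U : set Cn, open U -> U !=set0 -> exists j, U (s j).
Proof.
pose emb (M : 'rV[rat * rat]_n) : Cn :=
  \row_j Complex (ratr (M 0 j).1) (ratr (M 0 j).2).
exists (fun k => if unpickle k is Some M then emb M else 0) => U Uo [z Uz].
have /nbhs_ballP[e /= e0 eU] : nbhs z U by move: Uo; rewrite openE; apply.
have [er er0 ere] : exists2 er : R, 0 < er & er%:C%C <= e.
  exists (complex.Re e); first by rewrite -ltc_real.
  by move: e0; case: (e) => a b; rewrite ltcE lecE/= => /andP[/eqP -> _]; rewrite eqxx lexx.
have /choice[q qP] (j : 'I_n) := complex_rational_dense (z 0 j) er0.
exists (pickle (\row_j q j)); rewrite pickleK; apply: eU; split => // i j.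
rewrite /ball/= /emb !mxE ord1; apply: lt_le_trans ere.
by rewrite normr_normcE ltcR; exact: qP.
Qed.

Variables (Om : set Cn) (Oo : open Om).
Local Notation D := (Om : set (borelC R n)).
Let mD : measurable D := measurable_open Oo.

(** By continuity in the first variable, whether [c < f u w] can be decided on a
    dense sequence of points near [u]; this writes strict superlevel sets as
    countable combinations of measurable rectangles. *)
Lemma measurable_caratheodory (f : Cn -> Cn -> R) :
  (forall w u, Om w -> Om u -> {for u, continuous (fun v => f v w)}) ->
  (forall u, Om u -> measurable_fun D (f u)) ->
  measurable_fun (D `*` D) (fun x : borelC R n * borelC R n => f x.1 x.2).
Proof.
move=> cf mf.
have [s sdense] := rational_vectors_dense.
apply: (measurability _ (RGenOInfty.measurableE R)) => _ [_ [c ->] <-].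
pose r m : R := m.+1%:R^-1.
pose near m j : set (borelC R n) := (ball (s j) (r m)%:C%C)^°.
(* The points [s j] close to [u] satisfy [c + r m <= f (s j) w]. *)
pose cell m j : set (borelC R n * borelC R n) :=
  if s j \in Om then
    ((D `&` ~` near m j) `*` D) `|` (D `*` (D `&` f (s j) @^-1` `[c + r m, +oo[%classic))
  else D `*` D.
have r0 m : 0 < r m by rewrite /r invr_gt0.
have -> : (D `*` D) `&` (fun x => f x.1 x.2) @^-1` `]c, +oo[%classic =
    \bigcup_m \bigcap_j cell m j.
  apply/seteqP; split => -[u w] /=.
    move=> [[Ou Ow]]; rewrite in_itv/= andbT => cfuw.
    pose eta := (f u w - c) / 2.
    have eta0 : 0 < eta by rewrite /eta divr_gt0// subr_gt0.
    have /nbhs_ballP[e /= e0 eU] : nbhs u [set v | c + eta < f v w].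
      have := cf w u Ow Ou; move/cvgr_gt => /(_ (c + eta)); apply.
      by rewrite /eta; lra.
    have er0 : 0 < complex.Re e by rewrite -ltc_real.
    have [N hN] : exists N, forall m, (N <= m)%N -> r m < Num.min eta (complex.Re e).
      have m0 : 0 < Num.min eta (complex.Re e) by rewrite lt_min eta0.
      have [N hN] := ltr_add_invr m0; exists N => m Nm; rewrite add0r in hN.
      by apply: le_lt_trans hN; rewrite lef_pV2 ?posrE// ler_nat ltnS.
    have := hN N (leqnn _); rewrite lt_min => /andP[reta re].
    exists N => // j _; rewrite /cell; case: ifPn => [/set_mem Osj|_]; last by split.
    have [nj|nj] := pselect (near N j u); last by left.
    right; do 2 split => //=; rewrite in_itv/= andbT.
    have bu : ball u e (s j).
      have bs : ball u (r N)%:C%C (s j) by apply: ball_sym; exact: interior_subset nj.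
      apply: le_ball bs.
      by move: e0 re; case: (e) => a b; rewrite ltcE lecE/= => /andP[/eqP -> _] /ltW ->; rewrite eqxx.
    by rewrite (le_trans _ (ltW (eU _ bu)))// lerD2l ltW.
  move=> [m _ h].
  have [Ou Ow] : Om u /\ Om w.
    have := h 0%N I; rewrite /cell; case: ifPn => _ [] // [] //=.
    by move=> [].
    by move=> Ou [].
  split => //; rewrite in_itv/= andbT.
  apply: (@lt_le_trans _ _ (c + r m)); first by rewrite ltrDl.
  rewrite leNgt; apply/negP => fuw.
  have rh0 : 0 < (r m / 2)%:C%C by rewrite ltcR divr_gt0.
  have nu : nbhs u (Om `&` ball u (r m / 2)%:C%C `&` [set v | f v w < c + r m]).
    apply: filterI; last by have := cf w u Ow Ou; move/cvgr_lt; apply.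
    apply: filterI; first by move: Oo; rewrite openE; apply.
    exact: nbhsx_ballx.
  have [j [[Osj bsj] fsj]] : exists j,
      (Om `&` ball u (r m / 2)%:C%C `&` [set v | f v w < c + r m]) (s j).
    have [j] := sdense _ (open_interior _) (ex_intro _ u (nu : interior _ u)).
    by move=> /interior_subset; exists j.
  have := h j I; rewrite /cell mem_set// => -[[/= [_ nn] _]|[/= _ [_]]].
    apply: nn; apply: (@filterS _ _ _ (ball u (r m / 2)%:C%C)); last exact: nbhsx_ballx.
    move=> v buv; rewrite (_ : (r m)%:C%C = (r m / 2)%:C%C + (r m / 2)%:C%C).
      by apply: ball_triangle buv; exact: ball_sym.
    by rewrite -rmorphD/= -splitr.
  by rewrite in_itv/= andbT leNgt fsj.
apply: bigcupT_measurable => m; apply: bigcapT_measurable => j.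
rewrite /cell; case: ifPn => [/set_mem Osj|_]; last exact: measurableX.
have mnear : measurable (near m j).
  by apply: measurable_open; exact: open_interior.
apply: measurableU; apply: measurableX => //.
  by apply: measurableI => //; exact: measurableC.
exact: mf.
Qed.

End joint_measurability.

(** * The reproducing kernel *)

(** Positive quantities are written as exponentials below, so that identities
    between their real powers become linear identities between exponents. *)
Lemma powR_expR (R : realType) (a r : R) : expR a `^ r = expR (r * a).
Proof. by rewrite /powR gt_eqF ?expR_gt0// expRK. Qed.

Lemma pos_expR (R : realType) (x : R) : 0 < x -> exists a, x = expR a.
Proof. by move=> x0; exists (ln x); rewrite lnK. Qed.

Section cauchy_schwarz.
Variables (R : realType) (n : nat).
Local Notation C := R[i].
Local Notation Cn := 'rV[C]_n.
Variables (Om : set Cn) (Oo : open Om).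
Variable sigma : {measure set (borelC R n) -> \bar R}.

Lemma ipB_cauchy_schwarz (f g : Cn -> C) : L2 Om sigma f -> L2 Om sigma g ->
  normc (ipB Om sigma f g) <= normB Om sigma f * normB Om sigma g.
Proof.
move=> lf lg; rewrite -(ler_pM2l (ltr0n R 2)).
have -> : normB Om sigma f = Num.sqrt (normB Om sigma f ^+ 2).
  by rewrite sqrtr_sqr ger0_norm ?normB_ge0.
have -> : normB Om sigma g = Num.sqrt (normB Om sigma g ^+ 2).
  by rewrite sqrtr_sqr ger0_norm ?normB_ge0.
apply: optimize_scale; rewrite ?sqr_ge0// => s s0.
have cn (x : R) : 0 <= x -> normc x%:C%C = x.
  by move=> x0; rewrite /normc/= expr0n addr0 sqrtr_sqr ger0_norm.
have q0 : 0 < Num.sqrt s by rewrite sqrtr_gt0.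
have := ipB_le Oo (L2Z Oo (Num.sqrt s)%:C%C lf) (L2Z Oo (Num.sqrt s)^-1%:C%C lg).
have e1 : (Num.sqrt s)%:C%C * ((Num.sqrt s)^-1%:C%C : C)^* = 1.
  by rewrite conjE conjc_real -rmorphM/= divff ?gt_eqF// .
rewrite ipBZ// e1 mul1r.
have qi0 : 0 <= (Num.sqrt s)^-1 by rewrite invr_ge0 ltW.
rewrite !normBZ// (cn _ (ltW q0)) (cn _ qi0) !exprMn exprVn (sqr_sqrtr (ltW s0)).
rewrite ler_pdivlMr// mulrC => /le_trans; apply.
by rewrite [_^-1 * _]mulrC.
Qed.

End cauchy_schwarz.

Section kernel_facts.
Variables (R : realType) (n : nat) (B : bergman_type_space R n).
Local Notation C := R[i].
Local Notation Cn := 'rV[C]_n.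
Local Notation Om := (Omega B).
Local Notation D := (Omega B : set (borelC R n)).
Local Notation mu := (sigma B).
Local Notation K := (Defs.K B).

Definition kernel_norm (z : Cn) : R := normB Om mu (K z).
Definition kernel_abs (z w : Cn) : R := normc (K z w).
Local Notation N := kernel_norm.
Local Notation kk := kernel_abs.

Let Oo : open Om. Proof. exact: Omega_open. Qed.
Let mD : measurable D. Proof. exact: measurable_open. Qed.

Lemma kernel_bergman z : Om z -> bergmanC Om mu (K z).
Proof. by move=> Oz; have [h _ _] := K_reproducing B; exact: h. Qed.

Lemma kernel_L2 z : Om z -> L2 Om mu (K z).
Proof. by case/kernel_bergman. Qed.

Lemma kernel_norm_ge0 z : 0 <= N z. Proof. exact: normB_ge0. Qed.
Lemma kernel_abs_ge0 z w : 0 <= kk z w. Proof. exact: normc_ge0. Qed.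

Lemma bergman_reproducing f z : bergmanC Om mu f -> Om z -> f z = ipB Om mu f (K z).
Proof.
move=> bf Oz; have [_ h _] := K_reproducing B; rewrite (h f z bf Oz).
by apply: integralC_eq => w _; rewrite mulrC.
Qed.

Lemma bergman_pointwise_bound f z : bergmanC Om mu f -> Om z ->
  normc (f z) <= normB Om mu f * N z.
Proof.
move=> bf Oz; rewrite [f z](bergman_reproducing bf Oz).
by apply: ipB_cauchy_schwarz => //; [case: bf|exact: kernel_L2].
Qed.

Lemma kernel_conj z w : Om z -> Om w -> K z w = (K w z)^*.
Proof.
move=> Oz Ow; rewrite (bergman_reproducing (kernel_bergman Oz) Ow).
rewrite (bergman_reproducing (kernel_bergman Ow) Oz).
by apply: ipB_conj => //; exact: kernel_L2.
Qed.

Lemma kernel_absC z w : Om z -> Om w -> kk z w = kk w z.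
Proof. by move=> Oz Ow; rewrite /kk kernel_conj// normc_conj. Qed.

Lemma kernel_ipB z w : Om z -> Om w -> normc (ipB Om mu (K z) (K w)) = kk z w.
Proof. by move=> Oz Ow; rewrite -bergman_reproducing//; exact: kernel_bergman. Qed.

Lemma kernel_abs_diag z : Om z -> kk z z = N z ^+ 2.
Proof.
move=> Oz; rewrite -kernel_ipB// ipB_self//; last exact: kernel_L2.
by rewrite /normc/= expr0n addr0 sqrtr_sqr ger0_norm// sqr_ge0.
Qed.

Lemma kernel_abs_le z w : Om z -> Om w -> kk z w <= N z * N w.
Proof.
by move=> Oz Ow; apply: bergman_pointwise_bound => //; exact: kernel_bergman.
Qed.

(** Constants belong to the space because [sigma] is finite, so that no
    evaluation functional vanishes. *)
Lemma kernel_norm_gt0 z : Om z -> 0 < N z.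
Proof.
move=> Oz; rewrite lt_def kernel_norm_ge0 andbT; apply/eqP => N0.
have b1 : bergmanC Om mu (cst 1).
  split; first by move=> w _; exact: differentiable_cst.
  apply/L2P => //; split; first exact: measurable_cfun_cst.
  under eq_integral do rewrite Normc.normc1 expr1n.
  by rewrite integral_cst// mul1e -ge0_fin_numE// fin_num_measure.
have := bergman_pointwise_bound b1 Oz.
by rewrite N0 mulr0 Normc.normc1 ler10.
Qed.

Lemma phi_in z w : Om z -> Om w -> Om (phi B z w).
Proof. exact: phi_Omega. Qed.

(** On the unit disc this is the identity
    [1 - |phi_z w|^2 = (1 - |z|^2) (1 - |w|^2) / |1 - conj z w|^2]. *)
Lemma kernel_phi z w : Om z -> Om w -> kk z w * N (phi B z w) = N z * N w.
Proof.
move=> Oz Ow; have Nz := kernel_norm_gt0 Oz; have Nw := kernel_norm_gt0 Ow.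
have Np := kernel_norm_gt0 (phi_in Oz Ow).
have := K_phi Oz Ow; rewrite ipBZ//; [|exact: kernel_L2..].
have cn (x : R) : 0 <= x -> normc (x%:C%C)^-1 = x^-1.
  by move=> x0; rewrite Normc.normcV /normc/= expr0n addr0 sqrtr_sqr ger0_norm.
rewrite !Normc.normcM kernel_ipB// normc_conj !cn ?kernel_norm_ge0// => h.
have -> : kk z w = N z * N w * ((N z)^-1 * (N w)^-1 * kk z w).
  by field; rewrite !gt_eqF.
by rewrite h mulfVK// gt_eqF.
Qed.

Lemma kernel_abs_gt0 z w : Om z -> Om w -> 0 < kk z w.
Proof.
move=> Oz Ow; rewrite lt_def kernel_abs_ge0 andbT; apply/eqP => k0.
have := kernel_phi Oz Ow; rewrite k0 mul0r => /esym/eqP.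
by rewrite mulf_eq0 !gt_eqF ?kernel_norm_gt0.
Qed.

Lemma kernel_continuous z w : Om z -> Om w -> {for w, continuous (kk z)}.
Proof.
move=> Oz Ow; apply: (@continuous_comp _ _ _ (K z) (@normc R : C -> R)).
  by apply: (analytic_continuous (Om := Om)) => //; case: (kernel_bergman Oz).
exact: continuous_normc.
Qed.

(** By the reproducing property [N w] is the supremum over [v] of the continuous
    functions [kk v w / N v], hence lower semicontinuous. *)
Lemma measurable_kernel_norm : measurable_fun D N.
Proof.
apply: (measurability _ (RGenOInfty.measurableE R)) => _ [_ [c ->] <-].
have -> : D `&` N @^-1` `]c, +oo[%classic =
    \bigcup_(v in Om) (Om `&` kk v @^-1` `]c * N v, +oo[%classic).
  apply/seteqP; split => w /=; rewrite ?in_itv/= ?andbT.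
    move=> [Ow cw]; exists w => //; split => //=.
    by rewrite in_itv/= andbT kernel_abs_diag// expr2 ltr_pM2r// kernel_norm_gt0.
  move=> [v Ov [Ow]]; rewrite /= !in_itv/= !andbT => h; split => //.
  rewrite -(ltr_pM2r (kernel_norm_gt0 Ov)) (lt_le_trans h)//.
  by rewrite mulrC (le_trans (kernel_abs_le Ov Ow))// mulrC.
apply: measurable_open; apply: bigcup_open => v Ov.
apply: continuous_on_open_preimage => //.
by move=> w Ow; exact: kernel_continuous.
Qed.

Lemma measurable_kernel_abs z : Om z -> measurable_fun D (kk z).
Proof.
move=> Oz; apply: measurable_continuous_on => // w Ow; exact: kernel_continuous.
Qed.

Lemma measurable_kernel_abs2 :
  measurable_fun (D `*` D) (fun x : borelC R n * borelC R n => kk x.1 x.2).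
Proof.
apply: (@eq_measurable_fun _ _ _ _ _ (fun x : borelC R n * borelC R n => kk x.2 x.1)).
  by move=> x /set_mem [Ox1 Ox2]; exact: kernel_absC.
apply: (measurable_caratheodory Oo (f := fun u w => kk w u)).
  by move=> w u Ow Ou; exact: kernel_continuous.
move=> u Ou; apply: eq_measurable_fun (measurable_kernel_abs Ou).
by move=> w /set_mem Ow; exact: kernel_absC.
Qed.

Lemma measurable_phi z : Om z -> measurable_fun D (phi B z : borelC R n -> borelC R n).
Proof.
move=> Oz; apply: measurable_map_on => // w Ow.
by apply: differentiable_continuous; exact: phi_holomorphic.
Qed.

Lemma lambda_change_of_variables z (g : Cn -> \bar R) : Om z ->
  measurable_fun D g -> (forall w, Om w -> (0 <= g w)%E) ->
  (\int[mu]_(w in D) (g w * (N w ^+ 2)%:E) =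
   \int[mu]_(w in D) (g (phi B z w) * (N w ^+ 2)%:E))%E.
Proof.
move=> Oz mg g0; apply: density_change_of_variables => //.
- by apply: measurable_funX; exact: measurable_kernel_norm.
- by move=> w; exact: sqr_ge0.
- exact: measurable_phi.
- by move=> w Ow; exact: phi_in.
- move=> E EO mE; have := lambda_invariant Oz EO mE; rewrite /lambda => ->.
  congr integral; apply/seteqP; split => w /=.
    move=> [v Ev <-]; split; first by apply: phi_in => //; exact: EO.
    by rewrite phi_involution//; exact: EO.
  by move=> [Ow Ew]; exists (phi B z w) => //; rewrite phi_involution.
Qed.

(** The measure [|k_z|^2 dsigma] is the image of [sigma] under [phi_z]. *)
Lemma sigma_change_of_variables z (g : Cn -> \bar R) : Om z ->
  measurable_fun D g -> (forall w, Om w -> (0 <= g w)%E) ->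
  (\int[mu]_(w in D) (g w * ((kk z w / N z) ^+ 2)%:E) =
   \int[mu]_(w in D) g (phi B z w))%E.
Proof.
move=> Oz mg g0; have Nz := kernel_norm_gt0 Oz.
transitivity (\int[mu]_(w in D) (g w * ((kk z w / N z / N w) ^+ 2)%:E * (N w ^+ 2)%:E))%E.
  apply: eq_integral => w /set_mem Ow; rewrite -muleA -EFinM; congr (_ * _%:E)%E.
  by field; rewrite !gt_eqF ?kernel_norm_gt0.
rewrite (@lambda_change_of_variables z)//; last 2 first.
- apply: emeasurable_funM => //; apply/measurable_EFinP; apply: measurable_funX.
  apply: measurable_funM; last first.
    apply: (@eq_measurable_fun _ _ _ _ D (fun w => N w `^ (-1))).
      by move=> w _ /=; rewrite powR_inv1// kernel_norm_ge0.
    exact: (measurableT_comp (measurable_powR _) measurable_kernel_norm).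
  by apply: measurable_funM => //; exact: measurable_kernel_abs.
- by move=> w Ow; rewrite mule_ge0 ?g0// lee_fin sqr_ge0.
apply: eq_integral => w /set_mem Ow; rewrite -muleA -EFinM.
have Op := phi_in Oz Ow; have := kernel_phi Oz Op.
rewrite phi_involution// => h.
have -> : kk z (phi B z w) / N z / N (phi B z w) = (N w)^-1.
  have Nw := kernel_norm_gt0 Ow; have Np := kernel_norm_gt0 Op.
  apply: (mulIf (x := N w)); rewrite ?gt_eqF// mulVf ?gt_eqF//.
  by rewrite mulrAC (mulrAC _ _ (N w)) h; field; rewrite !gt_eqF.
by rewrite -exprMn mulVf ?gt_eqF ?kernel_norm_gt0// expr1n mule1.
Qed.

End kernel_facts.

(** * Rudin-Forelli estimates *)

Section kernel_estimates.
Variables (R : realType) (n : nat) (B : bergman_type_space R n).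
Local Notation C := R[i].
Local Notation Cn := 'rV[C]_n.
Local Notation Om := (Omega B).
Local Notation D := (Omega B : set (borelC R n)).
Local Notation mu := (sigma B).
Local Notation N := (kernel_norm B).
Local Notation kk := (kernel_abs B).
Local Notation kappa := (kappa B).

Let Oo : open Om. Proof. exact: Omega_open. Qed.
Let mD : measurable D. Proof. exact: measurable_open. Qed.

Lemma measurable_powR_kernel_norm b : measurable_fun D (fun w => N w `^ b).
Proof.
apply: (@measurableT_comp _ _ _ _ _ _ (fun x : R => x `^ b)).
  exact: measurable_powR.
exact: measurable_kernel_norm.
Qed.

Lemma measurable_powR_kernel_abs z a : Om z -> measurable_fun D (fun w => kk z w `^ a).
Proof.
move=> Oz; apply: (@measurableT_comp _ _ _ _ _ _ (fun x : R => x `^ a)).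
  exact: measurable_powR.
exact: measurable_kernel_abs.
Qed.

Lemma measurable_kernel_weight z a b : Om z ->
  measurable_fun D (fun w => (kk z w `^ a * N w `^ b)%:E).
Proof.
move=> Oz; apply/measurable_EFinP; apply: measurable_funM.
  exact: measurable_powR_kernel_abs.
exact: measurable_powR_kernel_norm.
Qed.

Lemma kernel_weight_ge0 z w a b : (0 <= (kk z w `^ a * N w `^ b)%:E)%E.
Proof. by rewrite lee_fin mulr_ge0 ?powR_ge0. Qed.

(** The integral in the Rudin-Forelli estimate, written against [sigma] and
    without the power of [N z]. *)
Definition kernel_integral a b z : \bar R :=
  (\int[mu]_(w in D) (kk z w `^ a * N w `^ b)%:E)%E.

Lemma integral_kernel_weightZ z a b c : Om z -> 0 <= c ->
  (\int[mu]_(w in D) (c * (kk z w `^ a * N w `^ b))%:E = c%:E * kernel_integral a b z)%E.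
Proof.
move=> Oz c0; rewrite -ge0_integralZl//.
- exact: measurable_kernel_weight.
- by move=> w _; exact: kernel_weight_ge0.
Qed.

Lemma rudin_forelli_weight r s : rudin_forelli Om mu (K B) r s ->
  exists2 M, 0 <= M & forall z, Om z ->
    (kernel_integral ((r + s) / 2) (2 - r) z <= (M * N z `^ s)%:E)%E.
Proof.
move=> [M hM]; exists (Num.max M 0) => [|z Oz]; first by rewrite le_max lexx orbT.
have := hM z Oz; rewrite /integral_lambda.
have Nz := kernel_norm_gt0 Oz.
rewrite (eq_integral (T := borelC R n) (fun w => (N z `^ (- s) * (kk z w `^ ((r + s) / 2) * N w `^ (2 - r)))%:E)).
  rewrite integral_kernel_weightZ ?powR_ge0// => h.
  move: h; rewrite powRN muleC -lee_pdivlMr ?invr_gt0 ?powR_gt0// invrK => h.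
  apply: (le_trans h); rewrite -EFinM lee_fin ler_wpM2r ?powR_ge0//.
  by rewrite le_max lexx.
move=> w /set_mem Ow; rewrite -EFinM; congr EFin.
rewrite kernel_ipB// -!/(kernel_norm B _).
have [a ha] := pos_expR Nz; have [b hb] := pos_expR (kernel_norm_gt0 Ow).
have [k hk] := pos_expR (kernel_abs_gt0 Oz Ow).
rewrite ha hb hk -powR_mulrn ?expR_ge0// !powR_expR -!expRD -expRN -!expRD.
by congr expR; ring.
Qed.

(** Raising [r] and [s] by the same amount multiplies the integrand by a power of
    [kk z w / (N z * N w) <= 1], so the restriction [s < kappa] can be dropped. *)
Lemma rudin_forelli_extended r s : 0 < kappa -> kappa < r -> 0 < s -> s < r ->
  exists2 M, 0 <= M & forall z, Om z ->
    (kernel_integral ((r + s) / 2) (2 - r) z <= (M * N z `^ s)%:E)%E.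
Proof.
move=> k0 kr s0 sr.
have [rf] : 0 < kappa < 2 /\ forall r s, kappa < r -> 0 < s -> s < kappa ->
    rudin_forelli Om mu (K B) r s.
  by case: (kappa_rudin_forelli B) => // -[k1 _]; move: k0; rewrite k1 ltxx.
have : Num.max 0 (kappa - (r - s)) < Num.min s kappa.
  by rewrite gt_max !lt_min s0 k0/=; apply/andP; split; lra.
(* Any [s1] in this interval is admissible together with [s1 + (r - s)]. *)
move=> /midf_lt; set s1 := (_ / 2) => -[].
rewrite gt_max lt_min => /andP[s1_gt0 s1_gt] /andP[s1s s1k] hrf.
have r1k : kappa < s1 + (r - s) by lra.
have [M M0 hM] := rudin_forelli_weight (hrf _ _ r1k s1_gt0 s1k).
exists M => // z Oz; have Nz := kernel_norm_gt0 Oz.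
set r1 := s1 + (r - s) in hM.
apply: (@le_trans _ _ (\int[mu]_(w in D) (N z `^ (s - s1) *
   (kk z w `^ ((r1 + s1) / 2) * N w `^ (2 - r1)))%:E)%E).
  apply: ge0_le_integral => //.
  - by move=> w _; exact: kernel_weight_ge0.
  - exact: measurable_kernel_weight.
  - by apply/measurable_EFinP; apply: measurable_funM => //;
      apply/measurable_EFinP; exact: measurable_kernel_weight.
  - move=> w Ow; rewrite lee_fin.
    have := kernel_abs_le Oz Ow.
    have [a ha] := pos_expR Nz; have [b hb] := pos_expR (kernel_norm_gt0 Ow).
    have [k hk] := pos_expR (kernel_abs_gt0 Oz Ow).
    rewrite ha hb hk !powR_expR -!expRD !ler_expR /r1 => kab.
    rewrite -subr_ge0 (_ : _ - _ = (s - s1) * (a + b - k)); last by field.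
    by rewrite mulr_ge0 ?subr_ge0// ltW.
rewrite integral_kernel_weightZ ?powR_ge0//.
apply: (@le_trans _ _ ((N z `^ (s - s1))%:E * (M * N z `^ s1)%:E)%E).
  by rewrite lee_wpmul2l ?lee_fin ?powR_ge0// hM.
rewrite -EFinM lee_fin mulrCA -powRD ?subrK//.
by rewrite (gt_eqF Nz) implybT.
Qed.

(** The change of variables [w = phi_z u] turns [kk z w ^ ((r + s) / 2)] into
    [kk z u ^ ((r - s) / 2)] and absorbs the growth in [z]. *)
Lemma rudin_forelli_bounded r s : 0 < kappa -> kappa < r -> 0 < s -> s < r ->
  exists2 M, 0 <= M & forall z, Om z ->
    (kernel_integral ((r - s) / 2) (2 - r) z <= M%:E)%E.
Proof.
move=> k0 kr s0 sr.
have [M M0 hM] := rudin_forelli_extended k0 kr s0 sr.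
exists M => // z Oz; have Nz := kernel_norm_gt0 Oz; have := hM z Oz.
have split2 c b (w : Cn) : Om w -> c * N w `^ (2 - b) = c * N w `^ (- b) * N w ^+ 2.
  move=> Ow; rewrite -mulrA; congr (_ * _).
  have [x ->] := pos_expR (kernel_norm_gt0 Ow).
  by rewrite -powR_mulrn ?expR_ge0// !powR_expR -expRD; congr expR; ring.
rewrite /kernel_integral (eq_integral (T := borelC R n) (fun w =>
    (kk z w `^ ((r + s) / 2) * N w `^ (- r))%:E * (N w ^+ 2)%:E)%E); last first.
  by move=> w /set_mem Ow; rewrite -EFinM split2.
rewrite (@lambda_change_of_variables _ _ _ z)//; last 2 first.
- exact: measurable_kernel_weight.
- by move=> w _; exact: kernel_weight_ge0.
rewrite (eq_integral (T := borelC R n) (fun u => (N z `^ s * (kk z u `^ ((r - s) / 2) * N u `^ (2 - r)))%:E)).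
  rewrite integral_kernel_weightZ ?powR_ge0// EFinM muleC (muleC M%:E).
  by rewrite muleC lee_pmul2l ?lte_fin ?powR_gt0.
move=> u /set_mem Ou; rewrite -EFinM; congr EFin.
have Op := phi_in Oz Ou.
have := kernel_phi Oz Op; rewrite phi_involution// => h1.
have h2 := kernel_phi Oz Ou; move: h1 h2.
have [a ha] := pos_expR Nz; have [b hb] := pos_expR (kernel_norm_gt0 Ou).
have [k hk] := pos_expR (kernel_abs_gt0 Oz Ou).
have [b' hb'] := pos_expR (kernel_norm_gt0 Op).
have [k' hk'] := pos_expR (kernel_abs_gt0 Oz Op).
rewrite ha hb hk hb' hk' -!expRD => /expR_inj e1 /expR_inj e2.
rewrite -powR_mulrn ?expR_ge0// !powR_expR -!expRD; congr expR.
have -> : k' = a + b' - b by lra.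
have -> : b' = a + b - k by lra.
by field.
Qed.

End kernel_estimates.

(** * Carleson embedding *)

Lemma sqr_root (R : realType) (x : \bar R) : (0 <= x)%E ->
  ((x `^ 2^-1) `^ 2)%E = x.
Proof. by move=> x0; rewrite -poweRrM mulVf ?pnatr_eq0// poweRe1. Qed.

Lemma sqr_rootM (R : realType) (x y : \bar R) : (0 <= x)%E -> (0 <= y)%E ->
  ((x `^ 2^-1 * y `^ 2^-1) `^ 2)%E = (x * y)%E.
Proof. by move=> x0 y0; rewrite poweRM ?poweR_ge0// !sqr_root. Qed.

Section carleson.
Variables (R : realType) (n : nat) (B : bergman_type_space R n).
Local Notation C := R[i].
Local Notation Cn := 'rV[C]_n.
Local Notation Om := (Omega B).
Local Notation D := (Omega B : set (borelC R n)).
Local Notation mu := (sigma B).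
Local Notation N := (kernel_norm B).
Local Notation kk := (kernel_abs B).
Local Notation kappa := (kappa B).

Let Oo : open Om. Proof. exact: Omega_open. Qed.
Let mD : measurable D. Proof. exact: measurable_open. Qed.

Lemma measurable_cfun_phi (G : Cn -> C) w : measurable_cfun Om G -> Om w ->
  measurable_cfun Om (fun x => G (phi B w x)).
Proof.
move=> [mr mi] Ow.
have sub : [set phi B w x | x in D] `<=` D by move=> _ [x Dx <-]; exact: phi_in.
split; [apply: (@measurable_comp _ _ _ _ _ _ D (fun x => complex.Re (G x)) D (phi B w)) |
        apply: (@measurable_comp _ _ _ _ _ _ D (fun x => complex.Im (G x)) D (phi B w))] => //;
  exact: measurable_phi.
Qed.

Lemma Lp_norm_root (p : R) (f : Cn -> C) : 0 < p ->
  ((\int[mu]_(x in D) (normc (f x) `^ p)%:E) `^ p^-1 = Lp_norm Om mu p f)%E.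
Proof.
move=> p0; have p1 : p != 0 by rewrite gt_eqF.
rewrite -Lnorm_patch_powR//; last by move=> z; exact: normc_ge0.
by rewrite -poweRrM mulfV// poweRe1// Lnorm_ge0.
Qed.

(** The exponent [alpha] of the Schur weight is subject to [alpha q < 2 - kappa] and
    [2 q - 2 < alpha q] for the weight of [weighted_kernel_bound] to be in [L^q], and
    to [alpha < 1] for both Rudin-Forelli integrals to have [s < r]. *)
Variables (p q alpha : R).
Hypothesis p0 : 0 < p.
Hypothesis q0 : 0 < q.
Hypothesis pq : p^-1 + q^-1 = 1.
Hypothesis kappa0 : 0 < kappa.
Hypothesis alpha0 : 0 < alpha.
Hypothesis alpha1 : alpha < 1.
Hypothesis alphaq_lt : alpha * q < 2 - kappa.
Hypothesis alphaq_gt : 2 * q - 2 < alpha * q.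

(** After [u = phi_w x] the left-hand side is [N w ^ alpha] times the integral of
    [|G o phi_w|] against [kk w x ^ (1 - alpha) N x ^ alpha]; Hölder's inequality
    and [rudin_forelli_bounded] conclude. *)
Lemma weighted_kernel_bound : exists2 M : R, 0 <= M &
  forall (G : Cn -> C) w, measurable_cfun Om G -> Om w ->
  (\int[mu]_(u in D) (normc (G u) * (kk w u * N u `^ alpha))%:E <=
   (M * N w `^ alpha)%:E * Lp_norm Om mu p (fun x => G (phi B w x)))%E.
Proof.
(* The exponents [r = 2 - alpha q] and [s = 2 - 2 q + alpha q] have
   [(r - s) / 2 = (1 - alpha) q] and [2 - r = alpha q]. *)
have rk : kappa < 2 - alpha * q by rewrite ltrBrDr addrC -ltrBrDr.
have s0 : 0 < 2 - 2 * q + alpha * q by move: alphaq_gt; rewrite -subr_gt0; lra.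
have sr : 2 - 2 * q + alpha * q < 2 - alpha * q.
  have : 0 < (1 - alpha) * q by rewrite mulr_gt0// subr_gt0.
  lra.
have [M M0 hM] := rudin_forelli_bounded kappa0 rk s0 sr.
exists (M `^ q^-1) => [|G w mG Ow]; first exact: powR_ge0.
have mGp := measurable_cfun_phi mG Ow; have Nw := kernel_norm_gt0 Ow.
have mnG := measurable_cfun_normc mG; have mnGp := measurable_cfun_normc mGp.
rewrite (eq_integral (T := borelC R n) (fun u => (normc (G u) *
    (kk w u `^ 1 * N u `^ (alpha - 2)))%:E * (N u ^+ 2)%:E)%E); last first.
  move=> u /set_mem Ou; rewrite -EFinM; congr EFin.
  rewrite -[RHS]mulrA -[in RHS](mulrA (kk w u `^ 1)) powRr1 ?kernel_abs_ge0//.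
  congr (_ * (_ * _)).
  have [x ->] := pos_expR (kernel_norm_gt0 Ou).
  by rewrite -powR_mulrn ?expR_ge0// !powR_expR -expRD; congr expR; ring.
rewrite (@lambda_change_of_variables _ _ _ w)//; last 2 first.
- apply/measurable_EFinP; apply: measurable_funM => //.
  by apply/measurable_EFinP; exact: measurable_kernel_weight.
- by move=> u _; rewrite lee_fin !mulr_ge0 ?powR_ge0 ?normc_ge0.
pose b u := kk w u `^ (1 - alpha) * N u `^ alpha.
have b0 u : 0 <= b u by rewrite mulr_ge0 ?powR_ge0.
have mb : measurable_fun D b by apply/measurable_EFinP; exact: measurable_kernel_weight.
rewrite (eq_integral (T := borelC R n) (fun u => (N w `^ alpha)%:E *
    (normc (G (phi B w u)) * b u)%:E)%E); last first.
  move=> u /set_mem Ou; rewrite -!EFinM; congr EFin.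
  rewrite [RHS]mulrCA -[LHS]mulrA; congr (_ * _); rewrite /b.
  have Op := phi_in Ow Ou.
  have := kernel_phi Ow Op; rewrite phi_involution// => h1.
  have h2 := kernel_phi Ow Ou; move: h1 h2.
  have [a ha] := pos_expR Nw; have [c hc] := pos_expR (kernel_norm_gt0 Ou).
  have [k hk] := pos_expR (kernel_abs_gt0 Ow Ou).
  have [c' hc'] := pos_expR (kernel_norm_gt0 Op).
  have [k' hk'] := pos_expR (kernel_abs_gt0 Ow Op).
  rewrite ha hc hk hc' hk' -!expRD => /expR_inj e1 /expR_inj e2.
  rewrite -powR_mulrn ?expR_ge0// !powR_expR -!expRD; congr expR.
  have -> : k' = a + c' - c by lra.
  have -> : c' = a + c - k by lra.
  by ring.
rewrite ge0_integralZl//; last 3 first.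
- by apply/measurable_EFinP; apply: measurable_funM.
- by move=> u _; rewrite lee_fin mulr_ge0 ?normc_ge0.
- by rewrite lee_fin powR_ge0.
rewrite [(M `^ _ * _)%:E]EFinM -muleA muleCA.
rewrite lee_wpmul2l ?lee_fin ?powR_ge0//.
apply: le_trans (hoelder_on mu mD mnGp mb _ b0 p0 q0 pq) _.
  by move=> u; exact: normc_ge0.
rewrite Lp_norm_root// muleC lee_wpmul2r ?Lnorm_ge0//.
rewrite -poweR_EFin; apply: gt0_ler_poweR.
- by rewrite invr_ge0 ltW.
- by rewrite in_itv/= leey andbT integral_ge0// => u _; rewrite lee_fin powR_ge0.
- by rewrite in_itv/= leey andbT lee_fin.
apply: le_trans (hM w Ow); rewrite le_eqVlt; apply/orP; left; apply/eqP.
apply: eq_integral => u /set_mem Ou; congr EFin; rewrite /b.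
have [c ->] := pos_expR (kernel_norm_gt0 Ou).
have [k ->] := pos_expR (kernel_abs_gt0 Ow Ou).
by rewrite !powR_expR -!expRD powR_expR; congr expR; field.
Qed.

Lemma conjugate_gt1 : 1 < q.
Proof.
by rewrite -invf_lt1// -pq ltrDr invr_gt0.
Qed.

(** Cauchy-Schwarz in the reproducing formula, after splitting the integrand by
    means of the weight [N ^ alpha]. *)
Lemma bergman_sqr_bound : exists2 M : R, 0 <= M &
  forall f u, bergmanC Om mu f -> Om u ->
  ((normc (f u) ^+ 2)%:E <= (M * N u `^ alpha)%:E *
    \int[mu]_(w in D) (kk u w * (normc (f w) ^+ 2 * N w `^ (- alpha)))%:E)%E.
Proof.
have q1 := conjugate_gt1.
(* The exponents [r = 2 - alpha] and [s = alpha] have [(r + s) / 2 = 1]. *)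
have rk : kappa < 2 - alpha.
  have := ltr_pMr q alpha0; rewrite q1 => aq; move: alphaq_lt aq; lra.
have sr : alpha < 2 - alpha by move: alpha1; lra.
have [M M0 hM] := rudin_forelli_extended kappa0 rk alpha0 sr.
exists M => // f u bf Ou; have [af lf] := bf; have [mf _] := lf.
have mnf := measurable_cfun_normc mf.
have mk z s : Om z -> measurable_fun D (fun w => kk z w `^ s).
  by move=> Oz; exact: measurable_powR_kernel_abs.
have mN s : measurable_fun D (fun w => N w `^ s) by exact: measurable_powR_kernel_norm.
pose a w := kk u w `^ (2^-1) * N w `^ (alpha / 2).
pose b w := kk u w `^ (2^-1) * (normc (f w) * N w `^ (- alpha / 2)).
have a0 w : 0 <= a w by rewrite mulr_ge0 ?powR_ge0.
have b0 w : 0 <= b w by rewrite !mulr_ge0 ?powR_ge0 ?normc_ge0.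
have ma : measurable_fun D a by apply: measurable_funM => //; exact: mk.
have mb : measurable_fun D b.
  by apply: measurable_funM; [exact: mk|apply: measurable_funM].
have two : (2 : R)^-1 + 2^-1 = 1 by lra.
have := hoelder_on mu mD ma mb a0 b0 (ltr0n R 2) (ltr0n R 2) two.
set X := (\int[mu]_(x in D) (a x `^ 2)%:E)%E.
set Y := (\int[mu]_(x in D) (b x `^ 2)%:E)%E => cs.
have X0 : (0 <= X)%E by apply: integral_ge0 => w _; rewrite lee_fin powR_ge0.
have Y0 : (0 <= Y)%E by apply: integral_ge0 => w _; rewrite lee_fin powR_ge0.
have fle : ((normc (f u))%:E <= X `^ 2^-1 * Y `^ 2^-1)%E.
  apply: le_trans cs; rewrite (bergman_reproducing bf Ou).
  apply: le_trans (normc_integralC_le Oo (integrableC_mul_conj Oo lf (kernel_L2 Ou))) _.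
  rewrite le_eqVlt; apply/orP; left; apply/eqP.
  apply: eq_integral => w /set_mem Ow; congr EFin.
  rewrite Normc.normcM normc_conj -/(kernel_abs B u w) /a /b.
  have [c ->] := pos_expR (kernel_norm_gt0 Ow).
  have [k ->] := pos_expR (kernel_abs_gt0 Ou Ow).
  rewrite !powR_expR.
  have -> : expR (2^-1 * k) * expR (alpha / 2 * c) *
      (expR (2^-1 * k) * (normc (f w) * expR (- alpha / 2 * c))) =
      normc (f w) * (expR (2^-1 * k) * expR (2^-1 * k) *
      (expR (alpha / 2 * c) * expR (- alpha / 2 * c))) by ring.
  by rewrite -!expRD; congr (_ * expR _); field.
have XE : X = kernel_integral B 1 alpha u.
  apply: eq_integral => w /set_mem Ow; congr EFin; rewrite /a.
  have [c ->] := pos_expR (kernel_norm_gt0 Ow).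
  have [k ->] := pos_expR (kernel_abs_gt0 Ou Ow).
  by rewrite !powR_expR -!expRD powR_expR; congr expR; field.
have YE : Y = (\int[mu]_(w in D) (kk u w * (normc (f w) ^+ 2 * N w `^ (- alpha)))%:E)%E.
  apply: eq_integral => w /set_mem Ow; congr EFin; rewrite /b.
  rewrite !powR_mulrn ?mulr_ge0 ?powR_ge0 ?normc_ge0// !exprMn.
  have [c ->] := pos_expR (kernel_norm_gt0 Ow).
  have [k ->] := pos_expR (kernel_abs_gt0 Ou Ow).
  rewrite !powR_expR -!expRM_natl.
  congr (expR _ * (_ * expR _)); by field.
have sq : (((normc (f u)) ^+ 2)%:E <= X * Y)%E.
  rewrite -powR_mulrn ?normc_ge0// -poweR_EFin.
  rewrite -(sqr_rootM X0 Y0).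
  by apply: gt0_ler_poweR => //; rewrite in_itv/= leey andbT ?lee_fin ?normc_ge0 ?mule_ge0 ?poweR_ge0.
apply: le_trans sq _; rewrite -YE lee_wpmul2r// XE.
have := hM u Ou; rewrite (_ : (2 - alpha + alpha) / 2 = 1); last by field.
by rewrite (_ : 2 - (2 - alpha) = alpha)//; ring.
Qed.

(** Inserting [bergman_sqr_bound] and exchanging the integrals leaves the integral
    of [weighted_kernel_bound].  The sum over [i] is carried along, for the
    supremum over [w] is only controlled after summation. *)
Lemma carleson_embedding : exists2 M : R, 0 <= M &
  forall (G : nat -> Cn -> C) (A : R), (forall i, measurable_cfun Om (G i)) ->
  (forall w, Om w -> (\sum_(0 <= i <oo)
     Lp_norm Om mu p (fun x => G i (phi B w x)) <= A%:E)%E) ->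
  forall f, bergmanC Om mu f ->
  (\sum_(0 <= i <oo) \int[mu]_(u in D) (normc (G i u) * normc (f u) ^+ 2)%:E <=
   (M * A * normB Om mu f ^+ 2)%:E)%E.
Proof.
have [M1 M10 hM1] := bergman_sqr_bound.
have [M2 M20 hM2] := weighted_kernel_bound.
exists (M1 * M2) => [|G A mG hA f bf]; first exact: mulr_ge0.
have [_ lf] := bf; have [mf _] := lf.
have mDD : measurable (D `*` D) by exact: measurableX.
pose H i (x : borelC R n * borelC R n) : R := normc (G i x.1) * N x.1 `^ alpha *
   (kk x.1 x.2 * (normc (f x.2) ^+ 2 * N x.2 `^ (- alpha))).
have H0 i x : 0 <= H i x by rewrite !mulr_ge0 ?powR_ge0 ?sqr_ge0 ?normc_ge0.
have mfst (g : Cn -> R) : measurable_fun D g ->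
    measurable_fun (D `*` D) (fun x : borelC R n * borelC R n => g x.1).
  move=> mg; apply: (@measurable_comp _ _ _ _ _ _ D) => //.
    by move=> _ [x [Dx _] <-].
  by apply: (measurable_funS measurableT) => //; exact: measurable_fst.
have msnd (g : Cn -> R) : measurable_fun D g ->
    measurable_fun (D `*` D) (fun x : borelC R n * borelC R n => g x.2).
  move=> mg; apply: (@measurable_comp _ _ _ _ _ _ D) => //.
    by move=> _ [x [_ Dx] <-].
  by apply: (measurable_funS measurableT) => //; exact: measurable_snd.
have mfw : measurable_fun D (fun w => normc (f w) ^+ 2 * N w `^ (- alpha)).
  apply: measurable_funM; last exact: measurable_powR_kernel_norm.
  by apply: measurable_funX; exact: measurable_cfun_normc.
have mH i : measurable_fun (D `*` D) (H i).
  apply: measurable_funM; apply: measurable_funM.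
  - exact: (mfst (fun u => normc (G i u)) (measurable_cfun_normc (mG i))).
  - exact: (mfst (fun u => N u `^ alpha) (measurable_powR_kernel_norm _)).
  - exact: measurable_kernel_abs2.
  - exact: (msnd (fun w => normc (f w) ^+ 2 * N w `^ (- alpha)) mfw).
pose h i x := ((H i \_ (D `*` D)) x)%:E.
have mh i : measurable_fun setT (h i).
  by apply/measurable_EFinP; apply/(measurable_restrictT _ mDD).
have h0 i x : (0 <= h i x)%E.
  by rewrite lee_fin /patch; case: ifP.
have hI i u : Om u -> (\int[mu]_w h i (u, w) = \int[mu]_(w in D) (H i (u, w))%:E)%E.
  move=> Ou; rewrite [RHS]integral_mkcond; apply: eq_integral => w _.
  rewrite /h /patch; case: ifPn => [/set_mem[_ Ow]|]; first by rewrite mem_set.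
  by case: ifPn => // /set_mem Ow; rewrite mem_set.
have hJ i w : Om w -> (\int[mu]_u h i (u, w) = \int[mu]_(u in D) (H i (u, w))%:E)%E.
  move=> Ow; rewrite [RHS]integral_mkcond; apply: eq_integral => u _.
  rewrite /h /patch; case: ifPn => [/set_mem[Ou _]|]; first by rewrite mem_set.
  by case: ifPn => // /set_mem Ou; rewrite mem_set.
have mI i : measurable_fun setT (fun u => \int[mu]_w h i (u, w))%E.
  exact: measurable_fun_fubini_tonelli_F.
have mJ i : measurable_fun setT (fun w => \int[mu]_u h i (u, w))%E.
  exact: measurable_fun_fubini_tonelli_G.
have Fubini i : (\int[mu]_u \int[mu]_w h i (u, w) = \int[mu]_w \int[mu]_u h i (u, w))%E.
  exact: fubini_tonelli.
have step1 i : (\int[mu]_(u in D) (normc (G i u) * normc (f u) ^+ 2)%:E <=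
    M1%:E * \int[mu]_u \int[mu]_w h i (u, w))%E.
  apply: (@le_trans _ _ (\int[mu]_(u in D) (M1%:E * \int[mu]_w h i (u, w)))%E); last first.
    rewrite ge0_integralZl//; last 2 first.
    - exact: (measurable_funS measurableT).
    - by move=> u _; apply: integral_ge0 => w _; exact: h0.
    rewrite lee_wpmul2l ?lee_fin//; apply: ge0_subset_integral => //.
    by move=> u _; apply: integral_ge0 => w _; exact: h0.
  apply: ge0_le_integral => //.
  - by move=> u _; rewrite lee_fin mulr_ge0 ?sqr_ge0 ?normc_ge0.
  - apply/measurable_EFinP; apply: measurable_funM; first exact: measurable_cfun_normc.
    by apply: measurable_funX; exact: measurable_cfun_normc.
  - by apply: emeasurable_funM => //; exact: (measurable_funS measurableT).
  - move=> u Ou; rewrite hI//.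
    rewrite (eq_integral (T := borelC R n) (fun w => (normc (G i u) * N u `^ alpha)%:E *
      (kk u w * (normc (f w) ^+ 2 * N w `^ (- alpha)))%:E)%E)//.
    rewrite ge0_integralZl//; last 3 first.
    + apply/measurable_EFinP; apply: measurable_funM => //; exact: measurable_kernel_abs.
    + by move=> w _; rewrite lee_fin !mulr_ge0 ?powR_ge0 ?sqr_ge0 ?normc_ge0.
    + by rewrite lee_fin mulr_ge0 ?powR_ge0 ?normc_ge0.
    rewrite EFinM [(normc (G i u) * _)%:E]EFinM muleA (muleA M1%:E) (muleC M1%:E) -2!muleA.
    rewrite lee_wpmul2l ?lee_fin ?normc_ge0// muleA -EFinM; exact: hM1.
have step2 w : Om w -> (\sum_(0 <= i <oo) \int[mu]_u h i (u, w) <=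
    (M2 * A * normc (f w) ^+ 2)%:E)%E.
  move=> Ow; have Nw := kernel_norm_gt0 Ow.
  apply: (@le_trans _ _ (\sum_(0 <= i <oo) (M2 * normc (f w) ^+ 2)%:E *
     Lp_norm Om mu p (fun x => G i (phi B w x)))%E); last first.
    rewrite nneseriesZl; last by move=> i _; exact: Lnorm_ge0.
    rewrite mulrAC (EFinM _ A) lee_wpmul2l ?hA// lee_fin mulr_ge0 ?sqr_ge0//.
  apply: lee_nneseries => [i _ _|i _]; first by apply: integral_ge0 => u _; exact: h0.
  rewrite hJ//.
  rewrite (eq_integral (T := borelC R n) (fun u => (normc (f w) ^+ 2 * N w `^ (- alpha))%:E *
     (normc (G i u) * (kk w u * N u `^ alpha))%:E)%E); last first.
    move=> u /set_mem Ou; rewrite -EFinM /H/= (kernel_absC Ou Ow); congr EFin; ring.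
  have mGi := measurable_cfun_normc (mG i).
  rewrite ge0_integralZl//; last 3 first.
  - apply/measurable_EFinP; apply: measurable_funM => //; apply: measurable_funM.
      exact: measurable_kernel_abs.
    exact: measurable_powR_kernel_norm.
  - by move=> u _; rewrite lee_fin !mulr_ge0 ?powR_ge0 ?normc_ge0.
  - by rewrite lee_fin mulr_ge0 ?sqr_ge0 ?powR_ge0.
  apply: (@le_trans _ _ ((normc (f w) ^+ 2 * N w `^ (- alpha))%:E *
     ((M2 * N w `^ alpha)%:E * Lp_norm Om mu p (fun x => G i (phi B w x))))%E).
    by rewrite lee_wpmul2l ?hM2// lee_fin mulr_ge0 ?sqr_ge0 ?powR_ge0.
  have e : N w `^ (- alpha) * N w `^ alpha = 1.
    have [x ->] := pos_expR Nw.
    by rewrite !powR_expR -expRD -[RHS]expR0; congr expR; ring.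
  have -> : M2 * normc (f w) ^+ 2 =
      normc (f w) ^+ 2 * N w `^ (- alpha) * (M2 * N w `^ alpha).
    by rewrite -[LHS]mulr1 -e; ring.
  by rewrite muleA -EFinM.
apply: (@le_trans _ _ (\sum_(0 <= i <oo) M1%:E * \int[mu]_w \int[mu]_u h i (u, w))%E).
  apply: lee_nneseries => [i _ _|i _]; last by rewrite -Fubini.
  by apply: integral_ge0 => u _; rewrite lee_fin mulr_ge0 ?sqr_ge0 ?normc_ge0.
rewrite nneseriesZl; last first.
  by move=> i _; apply: integral_ge0 => w _; apply: integral_ge0 => u _; exact: h0.
rewrite -integral_nneseries//; last first.
  by move=> i w _; apply: integral_ge0 => u _; exact: h0.
rewrite -!mulrA EFinM lee_wpmul2l ?lee_fin//.
apply: (@le_trans _ _ (\int[mu]_(w in D) ((M2 * A)%:E * (normc (f w) ^+ 2)%:E))%E).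
  rewrite [leRHS]integral_mkcond; apply: ge0_le_integral => //.
  - by move=> w _; apply: nneseries_ge0 => i _ _; apply: integral_ge0 => u _; exact: h0.
  - by apply: ge0_emeasurable_sum => // i w _ _; apply: integral_ge0 => u _; exact: h0.
  - apply/(measurable_restrictT _ mD); apply: emeasurable_funM => //.
    exact: measurable_sqr_normc.
  - move=> w _; rewrite /patch; case: ifPn => [/set_mem Ow|nOw].
      by rewrite -EFinM; exact: step2.
    rewrite eseries0// => i _ _; rewrite (eq_integral (cst 0%E)) ?integral0// => u _.
    by rewrite /h /patch; case: ifPn => // /set_mem[_ Ow]; move: nOw; rewrite mem_set.
have A0 : 0 <= A.
  rewrite -lee_fin; apply: le_trans (hA 0 (Omega0 B)).
  by apply: nneseries_ge0 => i _ _; exact: Lnorm_ge0.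
rewrite ge0_integralZl//; last 3 first.
- exact: measurable_sqr_normc.
- by move=> w _; rewrite lee_fin sqr_ge0.
- by rewrite lee_fin mulr_ge0.
by rewrite -normB_sqr// -EFinM mulrA.
Qed.

End carleson.

(** * Duality in the vector-valued Bergman space *)

Section vector_pairing.
Variables (R : realType) (n : nat).
Local Notation C := R[i].
Local Notation Cn := 'rV[C]_n.
Variables (Om : set Cn) (Oo : open Om).
Variable sigma : {measure set (borelC R n) -> \bar R}.
Implicit Types f g h : Cn -> ell2 R.

Lemma ipDr (x y z : ell2 R) : ip x (y + z) = ip x y + ip x z.
Proof. by rewrite ipC ipDl rmorphD/= -!ipC. Qed.

Lemma ipZr (a : C) (x y : ell2 R) : ip x (a *: y) = a^* * ip x y.
Proof. by rewrite ipC ipZl rmorphM/= -ipC. Qed.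

Lemma ip_l2Dl (a : C) f g h :
  integrableC Om sigma (fun z => ip (f z) (h z)) -> integrableC Om sigma (fun z => ip (g z) (h z)) ->
  ip_l2 Om sigma (a *: f + g) h = a * ip_l2 Om sigma f h + ip_l2 Om sigma g h.
Proof.
move=> cf cg; rewrite -integralCZ// -integralCD//; last exact: integrableCZ.
by apply: integralC_eq => z _; rewrite !fctE ipDl ipZl.
Qed.

Lemma ip_l2Dr (a : C) f g h :
  integrableC Om sigma (fun z => ip (f z) (g z)) -> integrableC Om sigma (fun z => ip (f z) (h z)) ->
  ip_l2 Om sigma f (a *: g + h) = a^* * ip_l2 Om sigma f g + ip_l2 Om sigma f h.
Proof.
move=> cg ch; rewrite -integralCZ// -integralCD//; last exact: integrableCZ.
by apply: integralC_eq => z _; rewrite !fctE ipDr ipZr.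
Qed.

Lemma ell2_normZ_sqr (a : C) (x : ell2 R) :
  ell2_norm (a *: x) ^+ 2 = normc a ^+ 2 * ell2_norm x ^+ 2.
Proof.
have := ip_self (a *: x); rewrite ipZl ipZr ip_self => /(congr1 (@complex.Re R)) /= <-.
by rewrite !complexReM !complexImM !complexReJ !complexImJ sqr_normc/=; ring.
Qed.

Lemma bergman_l2Z (a : C) f : bergman_l2 Om sigma f -> bergman_l2 Om sigma (a *: f).
Proof. by move=> bf; rewrite -[a *: f]addr0; apply: bergman_l2D => //; exact: bergman_l2_0. Qed.

Lemma normB_l2Z_sqr (a : C) f : bergman_l2 Om sigma f ->
  normB_l2 Om sigma (a *: f) ^+ 2 = normc a ^+ 2 * normB_l2 Om sigma f ^+ 2.
Proof.
move=> bf; have [_ laf] := bergman_l2Z a bf; have [_ lf] := bf; have [mf _] := lf.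
apply: EFin_inj; rewrite normB_l2_sqr// EFinM normB_l2_sqr//.
rewrite -ge0_integralZl//.
- by apply: eq_integral => z _; rewrite fctE ell2_normZ_sqr EFinM.
- exact: measurable_open.
- exact: measurable_ell2_norm2.
- by move=> z _; rewrite lee_fin sqr_ge0.
- by rewrite lee_fin sqr_ge0.
Qed.

(** The real form [Re <f, g>] gives equality of the real parts; testing against
    [i h] gives the imaginary parts. *)
Lemma bergman_riesz (k : Cn -> ell2 R) (M : R) :
  complete_subspace (bergman_l2 Om sigma) (L2_norm_l2 Om sigma) ->
  (forall h, bergman_l2 Om sigma h -> integrableC Om sigma (fun z => ip (k z) (h z))) ->
  (forall h, bergman_l2 Om sigma h ->
     normc (ip_l2 Om sigma k h) <= M * normB_l2 Om sigma h) ->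
  exists2 g, bergman_l2 Om sigma g &
    forall h, bergman_l2 Om sigma h -> ip_l2 Om sigma g h = ip_l2 Om sigma k h.
Proof.
move=> cpl ck kM.
have cip f h : bergman_l2 Om sigma f -> bergman_l2 Om sigma h ->
    integrableC Om sigma (fun z => ip (f z) (h z)).
  by move=> [_ lf] [_ lh]; exact: integrableC_ip.
have self f : bergman_l2 Om sigma f ->
    complex.Re (ip_l2 Om sigma f f) = normB_l2 Om sigma f ^+ 2.
  by move=> [_ lf]; exact: ip_l2_self.
have norm f : bergman_l2 Om sigma f ->
    Num.sqrt (complex.Re (ip_l2 Om sigma f f)) = normB_l2 Om sigma f.
  by move=> bf; rewrite self// sqrtr_sqr ger0_norm// normB_l2_ge0.
have [] := @riesz_representation R _ (bergman_l2 Om sigma)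
  (fun f g => complex.Re (ip_l2 Om sigma f g)) (L2_norm_l2 Om sigma)
  _ _ _ _ _ _ cpl (fun h => complex.Re (ip_l2 Om sigma k h)) M.
- exact: bergman_l2_0.
- by move=> a f g bf bg; rewrite addrC; exact: bergman_l2D.
- move=> a f g h bf bg bh; rewrite addrC ip_l2Dl; [|exact: cip..].
  by rewrite complexReD complexReM/= mul0r subr0 addrC.
- move=> f g [_ lf] [_ lg].
  by rewrite (ip_l2_conj Oo lg lf) complexReJ.
- by move=> f bf; rewrite self// sqr_ge0.
- move=> f bf; rewrite norm// /normB_l2 fineK// ge0_fin_numE ?Lnorm_ge0//.
  by case: bf => _ [].
- move=> a f g bf bg; rewrite addrC ip_l2Dr; [|exact: ck..].
  by rewrite complexReD complexReM complexReJ complexImJ/= oppr0 mul0r subr0 addrC.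
- by move=> f bf; rewrite norm// (le_trans (normr_Re_le _))// kM.
move=> g bg hg; exists g => // h bh.
have re := hg h bh.
have := hg _ (bergman_l2Z 'i%C bh).
have ih f : integrableC Om sigma (fun z => ip (f z) (h z)) ->
    ip_l2 Om sigma f ('i%C *: h) = ('i%C : C)^* * ip_l2 Om sigma f h.
  move=> cf; rewrite -integralCZ//; apply: integralC_eq => z _.
  by rewrite !fctE ipZr.
rewrite !ih; [|exact: ck|exact: cip].
rewrite !complexReM !complexReJ !complexImJ/= !mul0r !sub0r !mulN1r !opprK => im.
exact: complex_ext.
Qed.

End vector_pairing.

(** * The sesquilinear form of a Toeplitz operator *)

Lemma double_series_le (R : realType) (c : R) (a b1 b2 : nat -> nat -> \bar R) :
  0 <= c -> (forall i k, (0 <= a i k)%E) ->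
  (forall i k, (0 <= b1 i k)%E) -> (forall i k, (0 <= b2 i k)%E) ->
  (forall i k, (a i k <= c%:E * b1 i k + c%:E * b2 i k)%E) ->
  (\sum_(0 <= i <oo) \sum_(0 <= k <oo) a i k <=
   c%:E * (\sum_(0 <= i <oo) \sum_(0 <= k <oo) b1 i k) +
   c%:E * (\sum_(0 <= i <oo) \sum_(0 <= k <oo) b2 i k))%E.
Proof.
move=> c0 a0 b10 b20 ab.
have step (x y1 y2 : nat -> \bar R) : (forall k, (0 <= x k)%E) ->
    (forall k, (0 <= y1 k)%E) -> (forall k, (0 <= y2 k)%E) ->
    (forall k, (x k <= c%:E * y1 k + c%:E * y2 k)%E) ->
    (\sum_(0 <= k <oo) x k <=
     c%:E * (\sum_(0 <= k <oo) y1 k) + c%:E * (\sum_(0 <= k <oo) y2 k))%E.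
  move=> x0 y10 y20 xy; rewrite -nneseriesZl// -nneseriesZl// -nneseriesD.
  - by apply: lee_nneseries.
  - by move=> k _ _; rewrite mule_ge0 ?lee_fin.
  - by move=> k _ _; rewrite mule_ge0 ?lee_fin.
by apply: (step _ _ _) => i; [exact: nneseries_ge0..|exact: step].
Qed.

Section symbol.
Variables (R : realType) (n : nat) (B : bergman_type_space R n).
Local Notation C := R[i].
Local Notation Cn := 'rV[C]_n.
Local Notation Om := (Omega B).
Local Notation D := (Omega B : set (borelC R n)).
Local Notation mu := (sigma B).
Local Notation N := (kernel_norm B).
Local Notation kk := (kernel_abs B).
Local Notation e_ := (std_basis R).

Let Oo : open Om. Proof. exact: Omega_open. Qed.
Let mD : measurable D. Proof. exact: measurable_open. Qed.

Variables F Fadj : Cn -> bounded_operator R.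
Hypothesis F_measurable : measurable_op Om F.
Hypothesis F_adjoint : forall z, Om z -> is_adjoint (F z) (Fadj z).

(** The entry of [F z] in column [k] and row [i]. *)
Definition entry k i (z : Cn) : C := ip (F z (e_ k)) (e_ i).

Lemma adjoint_entry z k i : Om z -> ip (Fadj z (e_ i)) (e_ k) = (entry k i z)^*.
Proof. by move=> Oz; rewrite /entry (F_adjoint Oz) ipC. Qed.

(** The adjoint expands [F z x] in matrix entries, as its rows are the conjugated
    vectors [Fadj z (e_ i)]. *)
Lemma symbol_coordinate z (x : ell2 R) i : Om z -> F z x i = ip x (Fadj z (e_ i)).
Proof. by move=> Oz; rewrite -ip_basis (F_adjoint Oz). Qed.

Lemma symbol_coordinate_le z (x : ell2 R) i : Om z ->
  ((normc (F z x i))%:E <= \sum_(0 <= k <oo) (normc (x k) * normc (entry k i z))%:E)%E.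
Proof.
move=> Oz; rewrite symbol_coordinate// (le_trans (ip_series_le _ _))// le_eqVlt.
apply/orP; left; apply/eqP; apply: eq_eseriesr => k _.
by rewrite -(ip_basis (Fadj z (e_ i))) adjoint_entry// normc_conj.
Qed.

Lemma measurable_adjoint_basis i : measurable_l2 Om (fun z => Fadj z (e_ i)).
Proof.
move=> k; apply: (@measurable_cfun_eq _ _ _ (fun z => (entry k i z)^*)).
  by move=> z Oz; rewrite adjoint_entry.
by apply: measurable_cfunJ; exact: F_measurable.
Qed.

Lemma measurable_mult_op f : measurable_l2 Om f -> measurable_l2 Om (mult_op F f).
Proof.
move=> mf; apply/measurable_l2P => i.
apply: (@measurable_cfun_eq _ _ _ (fun z => ip (f z) (Fadj z (e_ i)))).
  by move=> z Oz; rewrite /mult_op symbol_coordinate.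
by apply: measurable_ip => //; exact: measurable_adjoint_basis.
Qed.

Lemma mult_opD (a : C) (f g : Cn -> ell2 R) : mult_op F (a *: f + g) = a *: mult_op F f + mult_op F g.
Proof. by apply/funext => z; exact: linearP. Qed.

Lemma mult_opZ (a : C) (f : Cn -> ell2 R) : mult_op F (a *: f) = a *: mult_op F f.
Proof. by apply/funext => z; exact: linearZ. Qed.

Section form.
Variable M : R.
Hypothesis M0 : 0 <= M.
Hypothesis carleson_col : forall k f, bergmanC Om mu f ->
  (\sum_(0 <= i <oo) \int[mu]_(u in D) (normc (entry k i u) * normc (f u) ^+ 2)%:E <=
   (M * normB Om mu f ^+ 2)%:E)%E.
Hypothesis carleson_row : forall i f, bergmanC Om mu f ->
  (\sum_(0 <= k <oo) \int[mu]_(u in D) (normc (entry k i u) * normc (f u) ^+ 2)%:E <=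
   (M * normB Om mu f ^+ 2)%:E)%E.

(** Dominates the pairing of [mult_op F f] with [h] pointwise. *)
Let majorant (f h : Cn -> ell2 R) (z : Cn) : \bar R :=
  (\sum_(0 <= i <oo) \sum_(0 <= k <oo)
     (normc (entry k i z) * normc (f z k) * normc (h z i))%:E)%E.

Let m_entry k i : measurable_fun D (fun z => normc (entry k i z)).
Proof. by apply: measurable_cfun_normc; exact: F_measurable. Qed.

Let term_ge0 (f h : Cn -> ell2 R) z k i :
  (0 <= (normc (entry k i z) * normc (f z k) * normc (h z i))%:E :> \bar R)%E.
Proof. by rewrite lee_fin !mulr_ge0 ?normc_ge0. Qed.

Let m_term (f h : Cn -> ell2 R) k i : measurable_l2 Om f -> measurable_l2 Om h ->
  measurable_fun D (fun z => (normc (entry k i z) * normc (f z k) * normc (h z i))%:E).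
Proof.
move=> /measurable_l2P mf /measurable_l2P mh; apply/measurable_EFinP.
apply: measurable_funM; first by apply: measurable_funM => //; exact: measurable_cfun_normc (mf k).
exact: measurable_cfun_normc (mh i).
Qed.

Let m_majorant f h : measurable_l2 Om f -> measurable_l2 Om h ->
  measurable_fun D (majorant f h).
Proof.
move=> mf mh; apply: ge0_emeasurable_sum.
  by move=> i z _ _; apply: nneseries_ge0 => k _ _; exact: (term_ge0 f h).
move=> i _; apply: ge0_emeasurable_sum => [k z _ _|k _]; first exact: (term_ge0 f h).
exact: m_term.
Qed.

Let majorantP f h z : Om z ->
  ((normc (ip (mult_op F f z) (h z)))%:E <= majorant f h z)%E.
Proof.
move=> Oz; apply: (le_trans (ip_series_le _ _)); rewrite /majorant.
apply: lee_nneseries => [i _ _|i _]; first by rewrite lee_fin mulr_ge0 ?normc_ge0.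
rewrite (eq_eseriesr (g := fun k => (normc (h z i))%:E *
    (normc (f z k) * normc (entry k i z))%:E)%E); last first.
  by move=> k _; rewrite -EFinM; congr EFin; ring.
rewrite nneseriesZl; last by move=> k _; rewrite lee_fin mulr_ge0 ?normc_ge0.
rewrite mulrC EFinM lee_wpmul2l ?lee_fin ?normc_ge0//.
exact: symbol_coordinate_le.
Qed.

Let integral_term_le f h k i : bergman_l2 Om mu f -> bergman_l2 Om mu h ->
  (\int[mu]_(z in D) (normc (entry k i z) * normc (f z k) * normc (h z i))%:E <=
   2^-1%:E * \int[mu]_(z in D) (normc (entry k i z) * normc (f z k) ^+ 2)%:E +
   2^-1%:E * \int[mu]_(z in D) (normc (entry k i z) * normc (h z i) ^+ 2)%:E)%E.
Proof.
move=> [_ [mf _]] [_ [mh _]].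
have /measurable_l2P mfk := mf; have /measurable_l2P mhi := mh.
have mt g : measurable_cfun Om g ->
    measurable_fun D (fun z => (normc (entry k i z) * normc (g z) ^+ 2)%:E).
  move=> mg; apply/measurable_EFinP; apply: measurable_funM => //.
  by apply: measurable_funX; exact: measurable_cfun_normc.
have t0 (g : Cn -> C) z : (0 <= (normc (entry k i z) * normc (g z) ^+ 2)%:E)%E.
  by rewrite lee_fin mulr_ge0 ?sqr_ge0 ?normc_ge0.
rewrite -!ge0_integralZl//; [|exact: mt|by move=> z _; exact: (t0 (fun z => h z i))
  |exact: mt|by move=> z _; exact: (t0 (fun z => f z k))].
rewrite -ge0_integralD//; last 4 first.
- by move=> z _; rewrite mule_ge0// ?lee_fin//; exact: (t0 (fun z => f z k)).
- by apply: emeasurable_funM => //; exact: mt.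
- by move=> z _; rewrite mule_ge0// ?lee_fin//; exact: (t0 (fun z => h z i)).
- by apply: emeasurable_funM => //; exact: mt.
apply: ge0_le_integral => //.
- exact: m_term.
- by apply: emeasurable_funD; apply: emeasurable_funM => //; exact: mt.
- move=> z _; rewrite -!EFinM -EFinD lee_fin.
  have := normc_ge0 (entry k i z); have := sqr_ge0 (normc (f z k) - normc (h z i)).
  move: (normc _) (normc _) (normc _) => x y c; nra.
Qed.

Let sum_col f : bergman_l2 Om mu f ->
  (\sum_(0 <= i <oo) \sum_(0 <= k <oo)
     \int[mu]_(z in D) (normc (entry k i z) * normc (f z k) ^+ 2)%:E <=
   (M * normB_l2 Om mu f ^+ 2)%:E)%E.
Proof.
move=> bf; have [_ lf] := bf.
have i0 k i : (0 <= \int[mu]_(z in D) (normc (entry k i z) * normc (f z k) ^+ 2)%:E)%E.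
  by apply: integral_ge0 => z _; rewrite lee_fin mulr_ge0 ?sqr_ge0 ?normc_ge0.
rewrite nneseries_interchange// EFinM (normB_coordinates Oo lf) -nneseriesZl; last first.
  by move=> k _; rewrite lee_fin sqr_ge0.
apply: lee_nneseries => [k _ _|k _]; first exact: nneseries_ge0.
by rewrite -EFinM; apply: carleson_col; exact: bergmanC_coordinate.
Qed.

Let sum_row h : bergman_l2 Om mu h ->
  (\sum_(0 <= i <oo) \sum_(0 <= k <oo)
     \int[mu]_(z in D) (normc (entry k i z) * normc (h z i) ^+ 2)%:E <=
   (M * normB_l2 Om mu h ^+ 2)%:E)%E.
Proof.
move=> bh; have [_ lh] := bh.
rewrite EFinM (normB_coordinates Oo lh) -nneseriesZl; last first.
  by move=> k _; rewrite lee_fin sqr_ge0.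
apply: lee_nneseries => [i _ _|i _].
  apply: nneseries_ge0 => k _ _; apply: integral_ge0 => z _.
  by rewrite lee_fin mulr_ge0 ?sqr_ge0 ?normc_ge0.
by rewrite -EFinM; apply: carleson_row; exact: bergmanC_coordinate.
Qed.

Let integral_majorant f h : bergman_l2 Om mu f -> bergman_l2 Om mu h ->
  (\int[mu]_(z in D) majorant f h z <=
   (M / 2 * normB_l2 Om mu f ^+ 2 + M / 2 * normB_l2 Om mu h ^+ 2)%:E)%E.
Proof.
move=> bf bh; have [_ [mf _]] := bf; have [_ [mh _]] := bh.
rewrite /majorant integral_nneseries//; last 2 first.
- by move=> i; apply: ge0_emeasurable_sum => [k z _ _|k _]; [exact: (term_ge0 f h)|exact: m_term].
- by move=> i z _; apply: nneseries_ge0 => k _ _; exact: (term_ge0 f h).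
pose I1 i k := (\int[mu]_(z in D) (normc (entry k i z) * normc (f z k) ^+ 2)%:E)%E.
pose I2 i k := (\int[mu]_(z in D) (normc (entry k i z) * normc (h z i) ^+ 2)%:E)%E.
have I10 i k : (0 <= I1 i k)%E.
  by apply: integral_ge0 => z _; rewrite lee_fin mulr_ge0 ?sqr_ge0 ?normc_ge0.
have I20 i k : (0 <= I2 i k)%E.
  by apply: integral_ge0 => z _; rewrite lee_fin mulr_ge0 ?sqr_ge0 ?normc_ge0.
apply: (@le_trans _ _ (2^-1%:E * (\sum_(0 <= i <oo) \sum_(0 <= k <oo) I1 i k) +
    2^-1%:E * (\sum_(0 <= i <oo) \sum_(0 <= k <oo) I2 i k))%E); last first.
  rewrite EFinD; apply: leeD.
    rewrite [M / 2]mulrC -mulrA (EFinM 2^-1) lee_wpmul2l ?lee_fin//; exact: sum_col.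
  rewrite [M / 2]mulrC -mulrA (EFinM 2^-1) lee_wpmul2l ?lee_fin//; exact: sum_row.
apply: (@le_trans _ _ (\sum_(0 <= i <oo) \sum_(0 <= k <oo)
    \int[mu]_(z in D) (normc (entry k i z) * normc (f z k) * normc (h z i))%:E)%E).
  rewrite le_eqVlt; apply/orP; left; apply/eqP; apply: eq_eseriesr => i _.
  by rewrite integral_nneseries// => k; exact: m_term.
apply: double_series_le => // i k; last exact: integral_term_le.
by apply: integral_ge0 => z _; exact: (term_ge0 f h).
Qed.

(** The form is defined on the whole space although [mult_op F f] need not be
    square-integrable. *)
Lemma toeplitz_form_integrable f h : bergman_l2 Om mu f -> bergman_l2 Om mu h ->
  integrableC Om mu (fun z => ip (mult_op F f z) (h z)).
Proof.
move=> bf bh; have [_ [mf _]] := bf; have [_ [mh _]] := bh.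
apply: (@integrableC_le _ _ _ Oo mu _ (majorant f h)).
- by apply: measurable_ip => //; exact: measurable_mult_op.
- exact: m_majorant.
- by move=> z; exact: majorantP.
- by apply: le_lt_trans (integral_majorant bf bh) _; rewrite ltry.
Qed.

Let toeplitz_form_sum f h : bergman_l2 Om mu f -> bergman_l2 Om mu h ->
  normc (ip_l2 Om mu (mult_op F f) h) <=
  M / 2 * normB_l2 Om mu f ^+ 2 + M / 2 * normB_l2 Om mu h ^+ 2.
Proof.
move=> bf bh; rewrite -lee_fin; apply: le_trans (integral_majorant bf bh).
have [_ [mf _]] := bf; have [_ [mh _]] := bh.
have cf := toeplitz_form_integrable bf bh; have [mc _] := cf.
apply: (le_trans (normc_integralC_le Oo cf)); apply: ge0_le_integral => //.
- by move=> z _; rewrite lee_fin normc_ge0.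
- by apply/measurable_EFinP; exact: measurable_cfun_normc.
- exact: m_majorant.
- by move=> z; exact: majorantP.
Qed.

(** Replacing [f] by [sqrt s f] and [h] by [h / sqrt s] leaves the form unchanged;
    optimizing in [s] makes the bound bilinear. *)
Lemma toeplitz_form_le f h : bergman_l2 Om mu f -> bergman_l2 Om mu h ->
  normc (ip_l2 Om mu (mult_op F f) h) <= M * normB_l2 Om mu f * normB_l2 Om mu h.
Proof.
move=> bf bh.
have M20 : 0 <= M / 2 by rewrite divr_ge0.
have -> : M * normB_l2 Om mu f * normB_l2 Om mu h =
    2 * (Num.sqrt (M / 2 * normB_l2 Om mu f ^+ 2) *
         Num.sqrt (M / 2 * normB_l2 Om mu h ^+ 2)).
  have sq (x : R) : 0 <= x -> Num.sqrt (M / 2 * x ^+ 2) = Num.sqrt (M / 2) * x.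
    by move=> x0; rewrite (sqrtrM _ M20) sqrtr_sqr ger0_norm.
  rewrite !sq ?normB_l2_ge0//.
  transitivity (2 * (Num.sqrt (M / 2) ^+ 2) * normB_l2 Om mu f * normB_l2 Om mu h); last by ring.
  by rewrite sqr_sqrtr// mulrCA divff// mulr1.
apply: optimize_scale => [||s s0]; try by rewrite (mulr_ge0 M20)// sqr_ge0.
have q0 : 0 < Num.sqrt s by rewrite sqrtr_gt0.
have cn (x : R) : 0 <= x -> normc x%:C%C = x.
  by move=> x0; rewrite /normc/= expr0n addr0 sqrtr_sqr ger0_norm.
have qi0 : 0 <= (Num.sqrt s)^-1 by rewrite invr_ge0 ltW.
have := toeplitz_form_sum (bergman_l2Z Oo (Num.sqrt s)%:C%C bf)
  (bergman_l2Z Oo (Num.sqrt s)^-1%:C%C bh).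
rewrite (normB_l2Z_sqr Oo _ bf) (normB_l2Z_sqr Oo _ bh).
rewrite (cn _ (ltW q0)) (cn _ qi0) exprVn (sqr_sqrtr (ltW s0)).
have -> : ip_l2 Om mu (mult_op F ((Num.sqrt s)%:C%C *: f)) ((Num.sqrt s)^-1%:C%C *: h) =
    ip_l2 Om mu (mult_op F f) h.
  apply: integralC_eq => z _; rewrite mult_opZ.
  rewrite [LHS](ipZr _ _ (h z)) [X in _ * X](ipZl _ (mult_op F f z)).
  rewrite conjE conjc_real mulrA -rmorphM/= mulVf ?gt_eqF//.
  by rewrite mul1r.
by move=> /le_trans; apply; rewrite le_eqVlt; apply/orP; left; apply/eqP; ring.
Qed.

Lemma toeplitz_operator_exists f : bergman_l2 Om mu f ->
  exists g, [/\ bergman_l2 Om mu g,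
    forall h, bergman_l2 Om mu h -> ip_l2 Om mu g h = ip_l2 Om mu (mult_op F f) h &
    normB_l2 Om mu g <= M * normB_l2 Om mu f].
Proof.
move=> bf.
have [g bg hg] := bergman_riesz Oo (@bergman_l2_complete _ _ B)
  (fun h => toeplitz_form_integrable bf (h := h)) (fun h => toeplitz_form_le bf (h := h)).
exists g; split => //.
have [_ lg] := bg.
have := toeplitz_form_le bf bg; rewrite -hg// => le.
have := le_trans (le_trans (ler_norm _) (normr_Re_le (ip_l2 Om mu g g))) le.
rewrite ip_l2_self// expr2.
have := normB_l2_ge0 Om mu g; rewrite le_eqVlt => /predU1P[<- _|g0].
  by rewrite mulr_ge0// normB_l2_ge0.
by rewrite ler_pM2r.
Qed.

End form.

(** The change of variables [phi_z] turns the squared norm into the sum over [i]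
    of the integrals of [|entry k i o phi_z|^2], which Hölder's inequality compares
    with [L^p] norms because [2 < p] and [sigma] is finite; each of these norms is at
    most [A], so their squares are summable. *)
Lemma L2_kernel_column (p A : R) k z : 2 < p -> Om z ->
  (\sum_(0 <= i <oo) Lp_norm Om mu p (fun w => entry k i (phi B z w)) <= A%:E)%E ->
  L2_l2 Om mu (fun w => K B z w *: F w (e_ k)).
Proof.
move=> p2 Oz hA.
have p0 : 0 < p by rewrite (lt_trans _ p2).
(* Conjugate exponents, applied to [|entry k i o phi_z|^2] and [1]. *)
pose a := p / 2; pose b := p / (p - 2).
have pm : 0 < p - 2 by rewrite subr_gt0.
have a0 : 0 < a by rewrite divr_gt0.
have b0 : 0 < b by rewrite divr_gt0.
have ab : a^-1 + b^-1 = 1 by rewrite /a /b; field; rewrite !gt_eqF.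
have A0 : 0 <= A.
  rewrite -lee_fin; apply: le_trans hA.
  by apply: nneseries_ge0 => i _ _; exact: Lnorm_ge0.
have me i : measurable_cfun Om (entry k i) by exact: F_measurable.
have mep i : measurable_cfun Om (fun w => entry k i (phi B z w)).
  exact: measurable_cfun_phi.
pose V := fine (mu D `^ b^-1)%E.
have VE : (mu D `^ b^-1 = V%:E)%E.
  rewrite /V fineK//; have : mu D \is a fin_num by exact: fin_num_measure.
  by case: (mu D).
have V0 : 0 <= V by rewrite fine_ge0// poweR_ge0.
have Lfin i : (Lp_norm Om mu p (fun w => entry k i (phi B z w)) <= A%:E)%E.
  apply: le_trans hA.
  have h j : (0 <= Lp_norm Om mu p (fun w => entry k j (phi B z w)))%E by exact: Lnorm_ge0.
  apply: (le_trans _ (nneseries_lim_ge i.+1 (P := xpredT) (m := 0%N) (fun j _ _ => h j))).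
  by rewrite big_nat_recr//= leeDr// sume_ge0.
have sqr_le i : (\int[mu]_(w in D) (normc (entry k i (phi B z w)) ^+ 2)%:E <=
    (V * A)%:E * Lp_norm Om mu p (fun w => entry k i (phi B z w)))%E.
  have mn := measurable_cfun_normc (mep i).
  have m2 : measurable_fun D (fun w => normc (entry k i (phi B z w)) ^+ 2).
    exact: measurable_funX.
  have := hoelder_on mu mD m2 (@measurable_cst _ _ _ _ D (1 : R)) _ _ a0 b0 ab.
  under eq_integral do rewrite mulr1.
  move=> /(_ (fun _ => sqr_ge0 _) (fun _ => ler01)) /le_trans; apply.
  have -> : (\int[mu]_(w in D) (1 `^ b)%:E = mu D)%E.
    by under eq_integral do rewrite powR1; rewrite integral_cst// mul1e.
  rewrite VE (_ : (\int[mu]_(x in D) _)%E =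
      (\int[mu]_(w in D) (normc (entry k i (phi B z w)) `^ p)%:E)%E); last first.
    apply: eq_integral => w _; congr EFin.
    by rewrite -powR_mulrn ?normc_ge0// -powRrM /a mulrC divfK.
  rewrite (_ : a^-1 = p^-1 * 2); last by rewrite /a invfM invrK.
  rewrite poweRrM Lp_norm_root// muleC EFinM -muleA lee_wpmul2l ?lee_fin//.
  have := Lfin i; have := Lnorm_ge0 mu p%:E ((fun w => (normc (entry k i (phi B z w)))%:E) \_ Om).
  rewrite /Lp_norm; case: ('N[_]_ _ [_])%E => [l||]//= l0 lA.
  by rewrite powR_mulrn// -EFinM lee_fin expr2 ler_wpM2r.
apply/L2_l2P; split.
  move=> i; apply: (@measurable_cfun_eq _ _ _ (fun w => K B z w * entry k i w)).
    by move=> w _; rewrite ipZl.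
  by apply: measurable_cfunM => //; have [] := kernel_L2 Oz.
have Nz := kernel_norm_gt0 Oz.
have mk2 i : measurable_fun D (fun w => (normc (entry k i w) ^+ 2)%:E).
  exact: measurable_sqr_normc.
apply: (@le_lt_trans _ _ ((N z ^+ 2)%:E * ((V * A)%:E * A%:E))%E); last first.
  by rewrite -!EFinM ltry.
rewrite (eq_integral (T := borelC R n) (fun w => (N z ^+ 2)%:E *
   \sum_(0 <= i <oo) (normc (entry k i w) ^+ 2)%:E * ((kk z w / N z) ^+ 2)%:E)%E); last first.
  move=> w /set_mem Ow; rewrite ell2_normZ_sqr -/(kernel_abs B z w).
  rewrite EFinM ell2_norm_sqr.
  have -> : (\sum_(0 <= i <oo) (normc (entry k i w) ^+ 2)%:E * ((kk z w / N z) ^+ 2)%:E =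
      ((kk z w / N z) ^+ 2)%:E * sqsum (F w (e_ k)))%E.
    rewrite /sqsum -nneseriesZl; last by move=> i _; rewrite lee_fin sqr_ge0.
    by apply: eq_eseriesr => i _; rewrite muleC /entry ip_basis.
  rewrite muleA -EFinM -exprMn; congr (_ * _)%E; congr EFin; congr (_ ^+ 2).
  by rewrite mulrC divfK// gt_eqF.
have mt i : measurable_fun D (fun w => (normc (entry k i w) ^+ 2)%:E * ((kk z w / N z) ^+ 2)%:E)%E.
  apply: emeasurable_funM => //; apply/measurable_EFinP; apply: measurable_funX.
  by apply: measurable_funM => //; exact: measurable_kernel_abs.
have t0 i w : (0 <= (normc (entry k i w) ^+ 2)%:E * ((kk z w / N z) ^+ 2)%:E)%E.
  by rewrite mule_ge0 ?lee_fin ?sqr_ge0.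
rewrite ge0_integralZl//; last 3 first.
- by apply: ge0_emeasurable_sum.
- by move=> w _; apply: nneseries_ge0.
- by rewrite lee_fin sqr_ge0.
rewrite lee_wpmul2l ?lee_fin ?sqr_ge0// integral_nneseries//.
apply: (@le_trans _ _ (\sum_(0 <= i <oo) (V * A)%:E *
    Lp_norm Om mu p (fun w => entry k i (phi B z w)))%E).
  apply: lee_nneseries => [i _ _|i _]; first exact: integral_ge0.
  rewrite (@sigma_change_of_variables _ _ _ z (fun w => (normc (entry k i w) ^+ 2)%:E))//.
  by move=> w _; rewrite lee_fin sqr_ge0.
rewrite nneseriesZl; last by move=> i _; exact: Lnorm_ge0.
by rewrite lee_wpmul2l// lee_fin mulr_ge0.
Qed.

End symbol.

(** * The span of the kernels *)

Section kernel_span.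
Variables (R : realType) (n : nat) (B : bergman_type_space R n).
Local Notation C := R[i].
Local Notation Cn := 'rV[C]_n.
Local Notation Om := (Omega B).
Local Notation D := (Omega B : set (borelC R n)).
Local Notation mu := (sigma B).
Local Notation e_ := (std_basis R).

Let Oo : open Om. Proof. exact: Omega_open. Qed.
Let mD : measurable D. Proof. exact: measurable_open. Qed.

Lemma bergman_l2_scale (g : Cn -> C) (h : ell2 R) : bergmanC Om mu g ->
  bergman_l2 Om mu (fun z => g z *: h).
Proof.
move=> [ag lg]; have [mg _] := lg; split.
  move=> k z Oz; rewrite (_ : (fun z => _) = ip h (e_ k) *: g).
    by apply: differentiableZ; exact: ag.
  by apply/funext => w; rewrite ipZl mulrC.
apply/L2_l2P; split.
  move=> k; apply: (@measurable_cfun_eq _ _ _ (fun w => g w * ip h (e_ k))).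
    by move=> w _; rewrite ipZl.
  by apply: measurable_cfunM => //; exact: measurable_cfun_cst.
under eq_integral do rewrite ell2_normZ_sqr EFinM muleC.
rewrite ge0_integralZl//; last 3 first.
- exact: measurable_sqr_normc.
- by move=> z _; rewrite lee_fin sqr_ge0.
- by rewrite lee_fin sqr_ge0.
by rewrite -normB_sqr// -EFinM ltry.
Qed.

Lemma finite_vector_sum (h : ell2 R) m : (forall k, (m <= k)%N -> ip h (e_ k) = 0) ->
  h = \sum_(k < m) h k *: e_ k.
Proof.
move=> hm; apply: ell2_ext => i.
have ip0 : ip (0 : ell2 R) (e_ i) = 0 by rewrite ip_basis.
rewrite -[RHS]ip_basis (big_morph (fun x => ip x (e_ i)) (fun x y => ipDl x y _) ip0).
have [mi|im] := leqP m i.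
  rewrite -ip_basis hm// big1// => k _; rewrite ip_basis scale_basisE.
  by rewrite gtn_eqF// (leq_trans (ltn_ord k)).
rewrite (bigD1 (Ordinal im))//= ip_basis scale_basisE eqxx big1 ?addr0// => k ki.
rewrite ip_basis scale_basisE; case: eqP => // ik; move: ki; rewrite -val_eqE/= ik.
by rewrite eqxx.
Qed.

Lemma L2_l2_0 : L2_l2 Om mu (0 : Cn -> ell2 R).
Proof. by have [] := bergman_l2_0 Om mu. Qed.

Lemma L2_l2_sum m (g : 'I_m -> Cn -> ell2 R) :
  (forall j, L2_l2 Om mu (g j)) -> L2_l2 Om mu (\sum_(j < m) g j).
Proof.
move=> lg; apply: (big_ind (L2_l2 Om mu)) => //; first exact: L2_l2_0.
by move=> f1 f2 l1 l2; rewrite -[f1]scale1r; exact: L2_l2D.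
Qed.

Lemma bergman_l2_sum m (g : 'I_m -> Cn -> ell2 R) :
  (forall j, bergman_l2 Om mu (g j)) -> bergman_l2 Om mu (\sum_(j < m) g j).
Proof.
move=> lg; apply: (big_ind (bergman_l2 Om mu)) => //; first exact: bergman_l2_0.
by move=> f1 f2 l1 l2; rewrite -[f1]scale1r; exact: bergman_l2D.
Qed.

(** The normalizing constants are absorbed into the vectors. *)
Lemma kernel_spanE (f : Cn -> ell2 R) : kernel_span B f ->
  exists m (z : 'I_m -> Cn) (h : 'I_m -> ell2 R),
    (forall j, Om (z j) /\ finite_vector (h j)) /\
    f = \sum_(j < m) (fun w => K B (z j) w *: h j).
Proof.
move=> [m [z [h [hj ->]]]].
exists m, z, (fun j => (real_complex R (normB Om mu (K B (z j))))^-1 *: h j); split.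
  move=> j; have [Oz [N hN]] := hj j; split=> //; exists N => k Nk.
  by rewrite ipZl hN// mulr0.
apply/funext => w; rewrite fct_sumE; apply: eq_bigr => j _.
by rewrite /normalized_kernel scalerA mulrC.
Qed.

Lemma kernel_span_bergman (f : Cn -> ell2 R) : kernel_span B f -> bergman_l2 Om mu f.
Proof.
move=> /kernel_spanE[m [z [h [hj ->]]]]; apply: bergman_l2_sum => j.
by apply: bergman_l2_scale; apply: kernel_bergman; case: (hj j).
Qed.

Lemma kernel_span_mult_op (F : Cn -> bounded_operator R) :
  (forall k z, Om z -> L2_l2 Om mu (fun w => K B z w *: F w (e_ k))) ->
  forall f, kernel_span B f -> L2_l2 Om mu (mult_op F f).
Proof.
move=> hF f /kernel_spanE[m [z [h [hj ->]]]].
have mD2 (f1 f2 : Cn -> ell2 R) : mult_op F (f1 + f2) = mult_op F f1 + mult_op F f2.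
  by apply/funext => w; exact: linearD.
have m0 : mult_op F 0 = 0 by apply/funext => w; exact: linear0.
rewrite (big_morph (mult_op F) mD2 m0); apply: L2_l2_sum => j.
have [Oz [N hN]] := hj j.
rewrite (_ : mult_op F _ = \sum_(k < N) (h j k *: (fun w => K B (z j) w *: F w (e_ k)))).
  apply: L2_l2_sum => k; rewrite -[_ *: _]addr0; apply: L2_l2D => //; last exact: L2_l2_0.
  exact: hF.
apply/funext => w; rewrite fct_sumE /mult_op {1}(finite_vector_sum hN).
rewrite linearZ/= linear_sum/= scaler_sumr; apply: eq_bigr => k _.
by rewrite linearZ/= scalerA mulrC -scalerA.
Qed.

End kernel_span.

(** * Boundedness of the Toeplitz operator *)

Lemma ereal_sup2_bound (R : realType) (I J : Type) (P : set J) (S : I -> J -> \bar R) :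
  (ereal_sup [set ereal_sup [set S i z | z in P] | i in [set: I]] < +oo)%E ->
  exists2 A : R, 0 <= A & forall i z, P z -> (S i z <= A%:E)%E.
Proof.
set s := ereal_sup _ => sfin; exists (Num.max 0 (fine s)); first by rewrite le_max lexx.
move=> i z Pz; apply: (@le_trans _ _ s).
  apply: (@le_trans _ _ (ereal_sup [set S i z | z in P])).
    by apply: ereal_sup_ubound; exists z.
  by apply: ereal_sup_ubound; exists i.
case: s sfin => [r||]//= _; last by rewrite leNye.
by rewrite lee_fin le_max lexx orbT.
Qed.

(** The constraints on [alpha * q] can be met when [q < 2 - kap / 2], which is the
    hypothesis on [p]. *)
Lemma schur_exponent (R : realType) (kap p : R) : 0 < kap < 2 ->
  (4 - kap) / (2 - kap) < p ->
  2 < p /\ exists q alpha : R, [/\ 0 < q, p^-1 + q^-1 = 1, 0 < alpha < 1,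
    alpha * q < 2 - kap & 2 * q - 2 < alpha * q].
Proof.
move=> /andP[k0 k2]; have k2' : 0 < 2 - kap by rewrite subr_gt0.
rewrite ltr_pdivrMr// => hp.
have p2 : 2 < p by rewrite -(ltr_pM2r k2'); apply: lt_trans hp; lra.
have pm : 0 < p - 1 by lra.
pose q := p / (p - 1).
have q0 : 0 < q by rewrite divr_gt0//; lra.
have qE : (q - 1) * (p - 1) = 1 by rewrite /q; field; rewrite gt_eqF.
have q2 : q < 2 - kap / 2.
  rewrite -subr_gt0 -(pmulr_lgt0 _ pm); nra.
have q1 : 1 < q by nra.
pose c := (2 * q - 2 + Num.min q (2 - kap)) / 2.
have /midf_lt : 2 * q - 2 < Num.min q (2 - kap) by rewrite lt_min; apply/andP; split; lra.
rewrite -/c => -[c1]; rewrite lt_min => /andP[cq ck].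
split => //; exists q, (c / q); split => //.
- by rewrite /q; field; rewrite !gt_eqF//; lra.
- have c0 : 0 < c by apply: lt_trans c1; lra.
  by rewrite divr_gt0// ltr_pdivrMr// mul1r.
- by rewrite divfK// gt_eqF.
- by rewrite divfK// gt_eqF.
Qed.

Theorem corollary3p3 (R : realType) (n : nat) (B : bergman_type_space R n)
  (kappa_gt0 : 0 < kappa B)
  (F Fadj : 'rV[R[i]]_n -> bounded_operator R)
  (F_measurable : measurable_op (Omega B) F)
  (F_adjoint : forall z, Omega B z -> is_adjoint (F z) (Fadj z))
  (p : R) (p_gt : (4 - kappa B) / (2 - kappa B) < p)
  (Fadj_bound :
    (ereal_sup [set ereal_sup [set \sum_(0 <= k <oo)
        Lp_norm (Omega B) (sigma B) p
          (fun w => ip (Fadj (phi B z w) (std_basis R i)) (std_basis R k))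
      | z in Omega B] | i in [set: nat]] < +oo)%E)
  (F_bound :
    (ereal_sup [set ereal_sup [set \sum_(0 <= i <oo)
        Lp_norm (Omega B) (sigma B) p
          (fun w => ip (F (phi B z w) (std_basis R k)) (std_basis R i))
      | z in Omega B] | k in [set: nat]] < +oo)%E) :
  toeplitz_bounded B F.
Proof.
have Oo : open (Omega B) by exact: Omega_open.
have k02 : 0 < kappa B < 2.
  by case: (kappa_rudin_forelli B) => [[]//|[k0 _]]; move: kappa_gt0; rewrite k0 ltxx.
have [p2 [q [alpha [q0 pq /andP[al0 al1] alq1 alq2]]]] := schur_exponent k02 p_gt.
have p0 : 0 < p by rewrite (lt_trans _ p2).
have [A1 A10 hA1] := ereal_sup2_bound Fadj_bound.
have [A2 A20 hA2] := ereal_sup2_bound F_bound.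
have [M0 M00 hM0] := carleson_embedding p0 q0 pq kappa_gt0 al0 al1 alq1 alq2.
pose M := M0 * (A1 + A2).
have AA (A : R) x : A <= A1 + A2 -> ((M0 * A * x ^+ 2)%:E <= (M * x ^+ 2)%:E)%E.
  by move=> h; rewrite lee_fin ler_wpM2r ?sqr_ge0// ler_wpM2l.
have M_ge0 : 0 <= M by rewrite mulr_ge0// addr_ge0.
have col k f : bergmanC (Omega B) (sigma B) f ->
    (\sum_(0 <= i <oo) \int[(sigma B)]_(u in ((Omega B) : set (borelC R n)))
       (normc (entry F k i u) * normc (f u) ^+ 2)%:E <= (M * normB (Omega B) (sigma B) f ^+ 2)%:E)%E.
  move=> bf; apply: le_trans (AA A2 _ _); last by rewrite lerDr.
  by apply: (hM0 (entry F k)) => // [i|w Ow]; [exact: F_measurable|exact: hA2].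
have row i f : bergmanC (Omega B) (sigma B) f ->
    (\sum_(0 <= k <oo) \int[(sigma B)]_(u in ((Omega B) : set (borelC R n)))
       (normc (entry F k i u) * normc (f u) ^+ 2)%:E <= (M * normB (Omega B) (sigma B) f ^+ 2)%:E)%E.
  move=> bf; apply: le_trans (AA A1 _ _); last by rewrite lerDl.
  rewrite (eq_eseriesr (g := fun k => \int[(sigma B)]_(u in ((Omega B) : set (borelC R n)))
     (normc (ip (Fadj u (std_basis R i)) (std_basis R k)) * normc (f u) ^+ 2)%:E)%E); last first.
    move=> k _; apply: eq_integral => u /set_mem Ou.
    by rewrite (adjoint_entry F_adjoint)// normc_conj.
  apply: (hM0 (fun k u => ip (Fadj u (std_basis R i)) (std_basis R k))) => // [k|w Ow].
    exact: measurable_adjoint_basis.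
  exact: hA1.
have exT f : exists g, bergman_l2 (Omega B) (sigma B) f -> [/\ bergman_l2 (Omega B) (sigma B) g,
    forall h, bergman_l2 (Omega B) (sigma B) h -> ip_l2 (Omega B) (sigma B) g h = ip_l2 (Omega B) (sigma B) (mult_op F f) h &
    normB_l2 (Omega B) (sigma B) g <= M * normB_l2 (Omega B) (sigma B) f].
  have [bf|nbf] := pselect (bergman_l2 (Omega B) (sigma B) f); last by exists 0.
  have [g hg] := toeplitz_operator_exists F_measurable F_adjoint M_ge0 col row bf.
  by exists g.
have [T TP] := choice exT.
have cform f h := @toeplitz_form_integrable _ _ B F Fadj F_measurable F_adjoint M col row f h.
have bK z k : (Omega B) z -> bergman_l2 (Omega B) (sigma B) (fun w => K B z w *: std_basis R k).
  by move=> Oz; apply: bergman_l2_scale; exact: kernel_bergman.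
(* The representer of the form determines [T f] pointwise through its pairings
   with the kernels, whence linearity and the formula for the projection. *)
have coord f z k : bergman_l2 (Omega B) (sigma B) f -> (Omega B) z ->
    T f z k = ip_l2 (Omega B) (sigma B) (mult_op F f) (fun w => K B z w *: std_basis R k).
  move=> bf Oz; have [bT hT _] := TP f bf; rewrite -hT; last exact: bK.
  have [_ _ rep] := K_reproducing B; rewrite -ip_basis (rep _ z k bT Oz).
  by apply: integralC_eq => w _; rewrite ip_scale_basis ip_basis mulrC.
exists T.
  split.
  - by move=> f bf; have [] := TP f bf.
  - move=> a f g z bf bg Oz; apply: ell2_ext => k.
    rewrite coord//; last exact: bergman_l2D.
    rewrite mult_opD ip_l2Dl; [|exact: Oo|exact: (cform _ _ bf (bK z k Oz))|exact: (cform _ _ bg (bK z k Oz))].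
    by rewrite -!coord// -[RHS]ip_basis ipDl ipZl !ip_basis.
  - by exists M => f bf; have [] := TP f bf.
(* On the span of the kernels [F f] is square-integrable, so there [T f] is the
   orthogonal projection of [F f], not only its representer. *)
have colL2 k z : (Omega B) z -> L2_l2 (Omega B) (sigma B) (fun w => K B z w *: F w (std_basis R k)).
  by move=> Oz; apply: (L2_kernel_column F_measurable p2 Oz (hA2 k z Oz)).
move=> f sf; have bf := kernel_span_bergman sf.
have lFf := kernel_span_mult_op colL2 sf.
have [bT hT _] := TP f bf; split => //; split => //.
  move=> h bh; have [_ lh] := bh; have [_ lT] := bT.
  rewrite (_ : mult_op F f - T f = (-1) *: T f + mult_op F f); last by rewrite scaleN1r addrC.
  rewrite ip_l2Dl; [|exact: Oo|exact: integrableC_ip|exact: cform].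
  by rewrite hT// mulN1r addNr.
move=> z k Oz; rewrite ip_basis coord//; apply: integralC_eq => w Ow.
rewrite ip_scale_basis ip_basis mulrC -(bergman_reproducing (kernel_bergman Ow) Oz).
by rewrite (kernel_conj Ow Oz).
Qed.
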